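(* Let $n\ge2$, $T=\{1,\dots,n-1\}$, $S=\{n,n+1,\dots,2n\}$, and let $so(2n,\mathbb C)$ act on $\mathcal A=\mathbb C[x_1,\dots,x_{2n}]$ by the representation attached to $(S,T)$ described in the context. Let $$\Delta=-\sum_{i=1}^{n-1}x_i\partial_{x_{n+i}}+\partial_{x_n}\partial_{x_{2n}},\qquad \eta=\sum_{i=1}^{n-1}x_{n+i}\partial_{x_i}+x_nx_{2n},$$ and $\mathcal H_{\langle k\rangle}=\{f\in\mathcal A_{\langle k\rangle}\mid\Delta(f)=0\}$. If $k\le0$, then $\mathcal A_{\langle k\rangle}=\mathcal H_{\langle k\rangle}\oplus\eta\mathcal A_{\langle k-2\rangle}$, and $\mathcal H_{\langle k\rangle}$ is an irreducible highest weight module with highest weight $-k\lambda_{n-2}+(k-1)\lambda_{n-1}+(k-1)\lambda_n$ and a corresponding highest weight vector $x_{n-1}^{-k}$. Moreover, the set of polynomials $$\sum_{r_1,\dots,r_{n-1}=0}^\infty\frac{\alpha_n!\,\alpha_{2n}!\,\prod_{i=1}^{n-1}\binom{\alpha_{n+i}}{r_i}\,(r_1+\cdots+r_{n-1})!}{(\alpha_n+r_1+\cdots+r_{n-1})!\,(\alpha_{2n}+r_1+\cdots+r_{n-1})!}\,x_n^{\alpha_n+r_1+\cdots+r_{n-1}}x_{2n}^{\alpha_{2n}+r_1+\cdots+r_{n-1}}\prod_{i=1}^{n-1}x_i^{\alpha_i+r_i}x_{n+i}^{\alpha_{n+i}-r_i},$$ where $\alpha_1,\dots,\alpha_{2n}\in\mathbb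 N$ satisfy $\alpha_n\alpha_{2n}=0$ and $\alpha_n+\sum_{i=1}^n\alpha_{n+i}-\sum_{i=1}^{n-1}\alpha_i=k$, forms a basis of $\mathcal H_{\langle k\rangle}$.
   Context: $\mathbb N$ denotes the nonnegative integers; $E_{i,j}$ are matrix units of size $2n$; $\binom{a}{r}=0$ for $r>a$. $$\mathcal G=so(2n,\mathbb C)=\sum_{i,j=1}^n\mathbb C(E_{i,j}-E_{n+j,n+i})+\sum_{1\le i<j\le n}[\mathbb C(E_{i,n+j}-E_{j,n+i})+\mathbb C(E_{n+j,i}-E_{n+i,j})].$$ Cartan subalgebra $H=\sum_{i=1}^n\mathbb C(E_{i,i}-E_{n+i,n+i})$; positive root vectors $E_{i,j}-E_{n+j,n+i}$, $E_{i,n+j}-E_{j,n+i}$ ($1\le i<j\le n$), spanning $\mathcal G_+$. With $h_i=E_{i,i}-E_{n+i,n+i}-E_{i+1,i+1}+E_{n+i+1,n+i+1}$ ($1\le i\le n-1$) and $h_n=E_{n-1,n-1}-E_{2n-1,2n-1}+E_{n,n}-E_{2n,2n}$, the fundamental weights $\lambda_1,\dots,\lambda_n\in H^*$ satisfy $\lambda_i(h_j)=\delta_{i,j}$; $\lambda_0=0$. The representation attached to a partition $(S,T)$ of $\{1,\dots,2n\}$ is the restriction to $\mathcal G$ of the representation of $gl(2n,\mathbb C)$ on $\mathcal A$: $E_{i,j}=x_i\partial_{x_j}$ if $i,j\in S$; $-x_ix_j$ if $i\in S,j\in T$; $\partial_{x_i}\partial_{x_j}$ if $i\in T,j\in S$;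 $-x_j\partial_{x_i}-\delta_{i,j}$ if $i,j\in T$. $\mathcal A_{\langle k\rangle}=\mathrm{Span}\{x^\alpha\mid\alpha\in\mathbb N^{2n},\sum_{i\in S}\alpha_i-\sum_{i\in T}\alpha_i=k\}$. The operators $\Delta,\eta$ commute with $\mathcal G$. A highest weight module is one generated by a nonzero $v$ with $H.v\subset\mathbb Cv$ and $\mathcal G_+.v=0$ (a highest weight vector), whose weight is the highest weight. *)

(* Defs.v *)
From HB Require Import structures.
From mathcomp Require Import all_boot all_order all_algebra.
From mathcomp Require Import reals complex mpoly.
From mathcomp Require Import zify ring lra.

Set Implicit Arguments.
Unset Strict Implicit.
Unset Printing Implicit Defensive.

Import Order.TTheory GRing.Theory Num.Theory.
Local Open Scope ring_scope.

(* Subspaces of a possibly infinite-dimensional space [V] are predicates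
   [V -> Prop]; families are indexed by the [i : I] satisfying [D]. *)
Section LinearAlgebra.
Context {K : fieldType} {V : lmodType K}.

Definition is_subspace (W : V -> Prop) : Prop :=
  W 0 /\ (forall (a : K) (u v : V), W u -> W v -> W (a *: u + v)).

Definition in_span {I : eqType} (D : pred I) (b : I -> V) (v : V) : Prop :=
  exists (s : seq I) (c : I -> K), all D s /\ v = \sum_(i <- s) c i *: b i.

Definition lin_indep {I : eqType} (D : pred I) (b : I -> V) : Prop :=
  forall (s : seq I) (c : I -> K), uniq s -> all D s ->
    \sum_(i <- s) c i *: b i = 0 -> forall i, i \in s -> c i = 0.

Definition is_basis {I : eqType} (D : pred I) (b : I -> V) (W : V -> Prop) :
    Prop :=
  lin_indep D b /\ (forall v, W v <-> in_span D b v).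

Definition is_direct_sum (W U1 U2 : V -> Prop) : Prop :=
  (forall v, W v <-> exists u1 u2, U1 u1 /\ U2 u2 /\ v = u1 + u2) /\
  (forall v, U1 v -> U2 v -> v = 0).

Definition image_of (f : V -> V) (U : V -> Prop) (v : V) : Prop :=
  exists2 u, U u & v = f u.

End LinearAlgebra.

(* [g] is a space of matrices acting on [V] through [rho]. *)
Section Modules.
Context {K : fieldType} {V : lmodType K} {N : nat}.
Variables (g : {vspace 'M[K]_N}) (rho : 'M[K]_N -> V -> V).

Definition is_submodule (W : V -> Prop) : Prop :=
  is_subspace W /\ (forall x v, x \in g -> W v -> W (rho x v)).

Definition is_irreducible (W : V -> Prop) : Prop :=
  [/\ is_submodule W,
      exists2 v, W v & v != 0 &
      forall U : V -> Prop, is_submodule U -> (forall v, U v -> W v) ->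
        (forall v, U v -> v = 0) \/ (forall v, W v -> U v)].

Definition generated_by (W : V -> Prop) (v : V) : Prop :=
  [/\ is_submodule W, W v &
      forall U : V -> Prop, is_submodule U -> U v -> forall w, W w -> U w].

Definition is_highest_weight_vector (h gpos : {vspace 'M[K]_N})
    (mu : 'Hom(subvs_of h, K^o)) (v : V) : Prop :=
  [/\ v != 0,
      forall x : subvs_of h, rho (vsval x) v = (mu x : K) *: v &
      forall x, x \in gpos -> rho x v = 0].

Definition is_highest_weight_module (h gpos : {vspace 'M[K]_N})
    (W : V -> Prop) (mu : 'Hom(subvs_of h, K^o)) (v : V) : Prop :=
  is_highest_weight_vector gpos mu v /\ generated_by W v.

End Modules.

Section OscillatorRepresentation.
Context {K : fieldType} {N : nat}.
(* The set [S] of the partition [(S, T)] is the complement of [T]. *)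
Variable T : {set 'I_N}.

Definition osc_unit (i j : 'I_N) (f : {mpoly K[N]}) : {mpoly K[N]} :=
  match i \in T, j \in T with
  | false, false => 'X_i * f^`M(j)
  | false, true => - ('X_i * 'X_j * f)
  | true, false => (f^`M(j))^`M(i)
  | true, true => - ('X_j * f^`M(i)) - (i == j)%:R *: f
  end.

Definition osc_rep (A : 'M[K]_N) (f : {mpoly K[N]}) : {mpoly K[N]} :=
  \sum_(i < N) \sum_(j < N) A i j *: osc_unit i j f.

Definition osc_degree (a : 'X_{1..N}) : int :=
  \sum_(i in ~: T) (a i)%:Z - \sum_(i in T) (a i)%:Z.

Definition osc_graded (k : int) : {mpoly K[N]} -> Prop :=
  in_span (fun a : 'X_{1..N} => osc_degree a == k) (fun a => 'X_[a]).

End OscillatorRepresentation.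

Lemma double_rank_gt0 (n : nat) : (2 <= n)%N -> (0 < 2 * n)%N.
Proof. by case: n. Qed.

(* Position of the index [i] of {1, ..., 2n} in ['I_(2 * n)]; the value for [i]
   outside this range is irrelevant. *)
Definition ix (n : nat) (hn : (2 <= n)%N) (i : nat) : 'I_(2 * n) :=
  insubd (Ordinal (double_rank_gt0 hn)) i.-1.

Lemma ixE (n : nat) (hn : (2 <= n)%N) (i : nat) :
  (0 < i <= 2 * n)%N -> (ix hn i : nat) = i.-1.
Proof. by move=> hi; rewrite /ix val_insubd ifT //; lia. Qed.

Section EvenOrthogonal.
Variables (R : realType) (n : nat) (hn : (2 <= n)%N).
Local Notation C := R[i].
Local Notation "'E_ ( i , j )" :=
  (delta_mx (ix hn i) (ix hn j) : 'M[C]_(2 * n)) (format "''E_' ( i ,  j )").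

Definition so_even : {vspace 'M[C]_(2 * n)} :=
  (\sum_(1 <= i < n.+1) \sum_(1 <= j < n.+1)
      <['E_(i, j) - 'E_((n + j)%N, (n + i)%N)]> +
   \sum_(1 <= i < n.+1) \sum_(i.+1 <= j < n.+1)
      (<['E_(i, (n + j)%N) - 'E_(j, (n + i)%N)]> +
       <['E_((n + j)%N, i) - 'E_((n + i)%N, j)]>))%VS.

Definition so_cartan : {vspace 'M[C]_(2 * n)} :=
  (\sum_(1 <= i < n.+1) <['E_(i, i) - 'E_((n + i)%N, (n + i)%N)]>)%VS.

Definition so_positive : {vspace 'M[C]_(2 * n)} :=
  (\sum_(1 <= i < n.+1) \sum_(i.+1 <= j < n.+1)
      (<['E_(i, j) - 'E_((n + j)%N, (n + i)%N)]> +
       <['E_(i, (n + j)%N) - 'E_(j, (n + i)%N)]>))%VS.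

Definition so_coroot (i : nat) : 'M[C]_(2 * n) :=
  if (i < n)%N then
    'E_(i, i) - 'E_((n + i)%N, (n + i)%N)
      - 'E_(i.+1, i.+1) + 'E_((n + i.+1)%N, (n + i.+1)%N)
  else
    'E_(n.-1, n.-1) - 'E_((2 * n).-1, (2 * n).-1)
      + 'E_(n, n) - 'E_((2 * n)%N, (2 * n)%N).

Definition so_weight := 'Hom(subvs_of so_cartan, C^o).

Definition is_fundamental_weights (lam : nat -> so_weight) : Prop :=
  lam 0%N = 0 /\
  forall i j : nat, (1 <= i <= n)%N -> (1 <= j <= n)%N ->
    lam i (vsproj so_cartan (so_coroot j)) = (i == j)%:R.

Let eps (i : nat) := 'E_(i, i) - 'E_((n + i)%N, (n + i)%N).

Let so_coroot_eps (j : nat) : so_coroot j =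
  if (j < n)%N then eps j - eps j.+1 else eps n.-1 + eps n.
Proof.
rewrite /so_coroot /eps; case: ifP => _; first by rewrite opprB !addrA addrAC.
have -> : (n + n.-1 = (2 * n).-1)%N by lia.
have -> : (n + n = 2 * n)%N by lia.
by rewrite !addrA.
Qed.

Let eps_cartan (i : nat) : (1 <= i <= n)%N -> eps i \in so_cartan.
Proof.
move=> hi; rewrite memvE /so_cartan (bigD1_seq i) /= ?iota_uniq //.
  by rewrite addvSl.
by rewrite mem_index_iota; lia.
Qed.

Lemma so_coroot_cartan (j : nat) :
  (1 <= j <= n)%N -> so_coroot j \in so_cartan.
Proof.
move=> hj; rewrite so_coroot_eps; case: ifP => h.
  by rewrite rpredB // eps_cartan //; lia.
by rewrite rpredD // eps_cartan //; lia.
Qed.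

Let psum0 (i : nat) (A : subvs_of so_cartan) : C^o :=
  \sum_(a < 2 * n | (a < i)%N) vsval A a a.

Let psum0_linear (i : nat) : linear (psum0 i).
Proof.
move=> c A B; rewrite /psum0 scaler_sumr -big_split (linearP (@vsval _ _ _)).
by apply: eq_bigr => a _; rewrite !mxE.
Qed.

Let psum (i : nat) : {linear subvs_of so_cartan -> C^o} :=
  HB.pack (psum0 i)
    (GRing.isLinear.Build C (subvs_of so_cartan) C^o _ (psum0 i)
       (psum0_linear i)).

Let psumE (i : nat) (A : 'M[C]_(2 * n)) : A \in so_cartan ->
  psum i (vsproj so_cartan A) = \sum_(a < 2 * n | (a < i)%N) A a a.
Proof. by move=> hA; rewrite /= /psum0 vsprojK. Qed.

Let diag_sum (i b : nat) : (1 <= b <= 2 * n)%N ->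
  \sum_(a < 2 * n | (a < i)%N) 'E_(b, b) a a = (b <= i)%:R.
Proof.
move=> hb; case: leqP => h.
  rewrite (bigD1 (ix hn b)) /=; last by rewrite ixE; lia.
  rewrite mxE !eqxx big1 ?addr0 // => a /andP[_ /negPf ha].
  by rewrite mxE ha.
apply: big1 => a ha; rewrite mxE; case: eqP => // e; exfalso.
by move: ha; rewrite e ixE; lia.
Qed.

Let psum_eps (i b : nat) : (i <= n)%N -> (1 <= b <= n)%N ->
  psum i (vsproj so_cartan (eps b)) = (b <= i)%:R.
Proof.
move=> hi hb; rewrite psumE ?eps_cartan // /eps.
under eq_bigr => a _ do rewrite mxE [X in _ + X]mxE.
rewrite big_split sumrN /= !diag_sum; try lia.
have -> : (n + b <= i)%N = false by lia.
by rewrite subr0.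
Qed.

Let psum_coroot (i j : nat) : (i <= n)%N -> (1 <= j <= n)%N ->
  psum i (vsproj so_cartan (so_coroot j)) =
  if (j < n)%N then (i == j)%:R else (n.-1 <= i)%:R + (n <= i)%:R.
Proof.
move=> hi hj; rewrite so_coroot_eps.
have dB x y : psum i (vsproj so_cartan (x - y)) =
  psum i (vsproj so_cartan x) - psum i (vsproj so_cartan y) by rewrite !linearB.
have dD x y : psum i (vsproj so_cartan (x + y)) =
  psum i (vsproj so_cartan x) + psum i (vsproj so_cartan y) by rewrite !linearD.
case: ifP => h.
  rewrite dB !psum_eps; try lia.
  by case: (ltngtP i j) => hij /=; rewrite ?subrr ?subr0.
by rewrite dD !psum_eps //; lia.
Qed.

Lemma fundamental_weights_exist :
  exists lam : nat -> so_weight, is_fundamental_weights lam.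
Proof.
pose half : C := 2%:R^-1.
have h2 : half + half = 1 by rewrite /half; field.
exists (fun i => if i == 0%N then 0 else
  if i == n then half *: linfun (psum n)
  else if i == n.-1 then linfun (psum n.-1) - half *: linfun (psum n)
  else linfun (psum i)).
split=> // i j hi hj.
have -> : (i == 0%N) = false by lia.
case: eqP => [->|hin].
  rewrite scale_lfunE lfunE psum_coroot ?leqnn ?leq_pred //; try lia.
  case: ifP => h.
    have -> : (n == j) = false by lia.
    by rewrite scaler0.
  have -> : n == j by lia.
  by rewrite scalerDr -scalerDl h2 scale1r.
case: eqP => [->|hin1].
  rewrite add_lfunE opp_lfunE scale_lfunE !lfunE !psum_coroot //; try lia.
  rewrite leqnn leq_pred leqnn; case: ifP => h.
    have -> : (n == j) = false by lia.
    by rewrite scaler0 subr0.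
  have -> : (n <= n.-1)%N = false by lia.
  have -> : (n.-1 == j) = false by lia.
  by rewrite scalerDr -scalerDl h2 scale1r addr0 subrr.
rewrite lfunE psum_coroot //; try lia.
case: ifP => // h.
have -> : (n.-1 <= i)%N = false by lia.
have -> : (n <= i)%N = false by lia.
have -> : (i == j) = false by lia.
by rewrite addr0.
Qed.

Local Notation A := {mpoly C[2 * n]}.
Local Notation x_ i := ('X_(ix hn i) : A).
Local Notation "'D_ i f" := (mderiv (ix hn i) f)
  (at level 10, i at level 8, f at level 8).

Definition osc_T : {set 'I_(2 * n)} := [set i : 'I_(2 * n) | (i.+1 < n)%N].

Definition so_rep : 'M[C]_(2 * n) -> A -> A := osc_rep osc_T.

Definition so_graded (k : int) : A -> Prop := osc_graded osc_T k.

Definition so_Delta (f : A) : A :=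
  - (\sum_(1 <= i < n) x_ i * 'D_(n + i) f) + 'D_n ('D_(2 * n) f).

Definition so_eta (f : A) : A :=
  \sum_(1 <= i < n) x_ (n + i) * 'D_i f + x_ n * x_ (2 * n) * f.

Definition so_harmonic (k : int) (f : A) : Prop :=
  so_graded k f /\ so_Delta f = 0.

Definition harmonic_index (k : int) (a : 'X_{1..2 * n}) : bool :=
  (a (ix hn n) * a (ix hn (2 * n)) == 0)%N &&
  ((a (ix hn n))%:Z + \sum_(1 <= i < n.+1) (a (ix hn (n + i)))%:Z
     - \sum_(1 <= i < n) (a (ix hn i))%:Z == k).

(* The sum over [r_1, ..., r_(n-1)], truncated to [r_i <= B]; the exponent
   [r_(i+1)] is [r i]. *)
Definition harmonic_sum (B : nat) (a : 'X_{1..2 * n}) : A :=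
  \sum_(r : {ffun 'I_n.-1 -> 'I_B.+1})
    let s := (\sum_(i < n.-1) r i)%N in
    (((a (ix hn n))`! * (a (ix hn (2 * n)))`!
       * (\prod_(i < n.-1) 'C(a (ix hn (n + i.+1)), r i)) * s`!)%:R
     / ((a (ix hn n) + s)`! * (a (ix hn (2 * n)) + s)`!)%:R) *:
    (x_ n ^+ (a (ix hn n) + s) * x_ (2 * n) ^+ (a (ix hn (2 * n)) + s)
     * \prod_(i < n.-1) (x_ i.+1 ^+ (a (ix hn i.+1) + r i)
         * x_ (n + i.+1) ^+ (a (ix hn (n + i.+1)) - r i))).

(* The binomials vanish as soon as some [r_i] exceeds [mdeg a], so that this is
   the sum over all [r] (lemma [harmonic_sum_stable]). *)
Definition harmonic_poly (a : 'X_{1..2 * n}) : A := harmonic_sum (mdeg a) a.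

Lemma harmonic_sum_stable (B : nat) (a : 'X_{1..2 * n}) :
  (mdeg a <= B)%N -> harmonic_sum B a = harmonic_poly a.
Proof.
move=> hB; rewrite /harmonic_poly /harmonic_sum.
have hw : ((mdeg a).+1 <= B.+1)%N by [].
pose w (r : {ffun 'I_n.-1 -> 'I_(mdeg a).+1}) : {ffun 'I_n.-1 -> 'I_B.+1} :=
  [ffun i => widen_ord hw (r i)].
rewrite (bigID (fun r : {ffun 'I_n.-1 -> 'I_B.+1} =>
  [forall i, (r i <= mdeg a)%N])) /=.
rewrite [X in _ + X]big1 ?addr0; last first.
  move=> r /forallPn[i hi]; rewrite (bigD1 i) //= bin_small.
    by rewrite mul0n muln0 mul0n mul0r scale0r.
  rewrite -ltnNge in hi; apply: leq_ltn_trans hi.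
  by rewrite mdegE (bigD1 (ix hn (n + i.+1))) //= leq_addr.
rewrite (reindex w) /=; last first.
  pose w' (r : {ffun 'I_n.-1 -> 'I_B.+1}) :
    {ffun 'I_n.-1 -> 'I_(mdeg a).+1} := [ffun i => inord (r i)].
  exists w' => r hr; apply/ffunP=> i.
    by apply: val_inj; rewrite !ffunE /= inordK.
  apply: val_inj; rewrite !ffunE /= inordK // ltnS.
  by move: hr; rewrite inE => /forallP.
apply: eq_big => [r|r _].
  by apply/forallP => i; rewrite ffunE /= -ltnS.
have e i : (w r i : nat) = r i by rewrite ffunE.
have -> : (\sum_(i < n.-1) w r i = \sum_(i < n.-1) r i)%N.
  by apply: eq_bigr.
congr (((_ * _ * _)%:R / _) *: (_ * _)); apply: eq_bigr => i _; by rewrite e.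
Qed.

End EvenOrthogonal.

Arguments so_even R {n} hn.
Arguments so_cartan R {n} hn.
Arguments so_positive R {n} hn.
Arguments so_weight R {n} hn.
Arguments so_graded R n k : clear implicits.
Arguments so_rep R n : clear implicits.
Arguments so_harmonic R {n} hn k f.
Arguments harmonic_poly R {n} hn a.

(* Main.v *)
Require Import Defs.
From Stdlib Require Import Classical_Prop FunctionalExtensionality.
From HB Require Import structures.
From mathcomp Require Import all_boot all_order all_algebra.
From mathcomp Require Import reals complex mpoly.
From mathcomp Require Import zify ring.

Set Implicit Arguments.
Unset Strict Implicit.
Unset Printing Implicit Defensive.

Import Order.TTheory GRing.Theory Num.Theory.
Local Open Scope ring_scope.

(* For every index i put cre_i = x_i, ann_i = d_i if i is in S, and cre_i =
   d_i, ann_i = - x_i if i is in T. Then [ann_i, cre_j] = delta_(i,j),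
   E_(i,j) acts as cre_i ann_j, and with i* the index i +- n
     Delta = (1/2) sum_i ann_i ann_(i* ),   eta = (1/2) sum_i cre_i cre_(i* ).
   On A_<k> one has Delta eta = eta Delta + (k + 1), and Delta is locally
   nilpotent; hence Delta eta is bijective on A_<k-2> for k <= 0, which
   gives the direct sum. A harmonic polynomial is determined by its
   coefficients at the monomials free of x_n x_(2n), and exactly one of
   these monomials occurs in each polynomial of the stated family: this
   gives the basis.

   Any member of the family is reached from x_(n-1)^(-k): the elements
   E_(w,i) - E_(i*,w* ) with i in T and w = n or 2n exchange x_(w* ) for
   x_(i* ), or create x_w x_i, and the Levi part of T moves x_(n-1) to x_i.
   Finally the Fischer form, twisted by signs, makes E_(i,j) - E_(j*,i* )
   adjoint to its transpose up to sign and Delta adjoint to - eta; by the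
   direct sum it is nondegenerate on H_<k>. A submodule either is orthogonal
   to x_(n-1)^(-k), hence to the module which it generates, and is then
   zero, or contains x_(n-1)^(-k), whose weight is multiplicity free in
   A_<k>. *)

Section Subspaces.
Context {K : fieldType} {V : lmodType K}.
Implicit Types (W : V -> Prop) (u v : V).

Lemma subspaceD W u v : is_subspace W -> W u -> W v -> W (u + v).
Proof. by case=> _ h hu hv; rewrite -[u]scale1r; apply: h. Qed.

Lemma subspaceZ W c v : is_subspace W -> W v -> W (c *: v).
Proof. by case=> h0 h hv; rewrite -[_ *: _]addr0; apply: h. Qed.

Lemma subspaceN W v : is_subspace W -> W v -> W (- v).
Proof. by move=> sW hv; rewrite -scaleN1r; apply: subspaceZ. Qed.

Lemma subspaceB W u v : is_subspace W -> W u -> W v -> W (u - v).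
Proof. by move=> sW hu hv; apply: subspaceD => //; apply: subspaceN. Qed.

Lemma subspace_sum W (I : Type) (r : seq I) (P : pred I) (F : I -> V) :
  is_subspace W -> (forall i, P i -> W (F i)) -> W (\sum_(i <- r | P i) F i).
Proof.
move=> sW hF; apply: big_ind => // [|u v]; first by case: sW.
exact: subspaceD.
Qed.

Lemma memv_big_add_ind (vT : vectType K) (P : vT -> Prop) (I : Type)
    (r : seq I) (Q : pred I) (U : I -> {vspace vT}) :
  P 0 -> (forall x y, P x -> P y -> P (x + y)) ->
  (forall i, Q i -> forall x, x \in U i -> P x) ->
  forall x, x \in (\sum_(i <- r | Q i) U i)%VS -> P x.
Proof.
move=> P0 PD PU.
apply: (big_ind (fun W : {vspace vT} => forall x, x \in W -> P x)) => //.
  by move=> x; rewrite memv0 => /eqP->.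
by move=> W1 W2 h1 h2 x /memv_addP[y /h1 hy [z /h2 hz ->]]; apply: PD.
Qed.

End Subspaces.

(** * Operators satisfying the relation of sl(2) *)

Section LoweringRaising.
Context {K : numFieldType} {V : lmodType K}.
Variables (D E : {linear V -> V}) (gr : int -> V -> Prop).
Hypothesis gr_subspace : forall k, is_subspace (gr k).
Hypothesis grD : forall (k : int) v, gr k v -> gr (k - 2) (D v).
Hypothesis grE : forall (k : int) v, gr (k - 2) v -> gr k (E v).
Hypothesis commDE :
  forall (k : int) v, gr k v -> D (E v) = E (D v) + (k + 1)%:~R *: v.
Hypothesis D_nilpotent : forall v, exists s, iter s D v = 0.

Lemma iter_linear0 s : iter s D 0 = 0.
Proof. by elim: s => //= s ->; rewrite linear0. Qed.

Lemma iter_linearBZ s c u v :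
  iter s D (u - c *: v) = iter s D u - c *: iter s D v.
Proof. by elim: s => //= s ->; rewrite linearB linearZ. Qed.

Lemma gr_iter (k : int) s v : gr k v -> gr (k - s%:Z *+ 2) (iter s D v).
Proof.
elim: s => [|s ih] hv /=; first by rewrite subr0.
have -> : k - s.+1%:Z *+ 2 = k - s%:Z *+ 2 - 2 by lia.
exact/grD/ih.
Qed.

Lemma iter_commDE (k : int) s v : gr k v ->
  iter s D (D (E v)) =
    E (iter s.+1 D v) + (s.+1%:Z * (k - s%:Z + 1))%:~R *: iter s D v.
Proof.
move=> hv; elim: s => [|s ih]; first by rewrite (commDE hv) subr0 mul1r.
rewrite iterS ih linearD linearZ /= (commDE (gr_iter s.+1 hv)) -addrA.
rewrite -scalerDl -rmorphD /=; congr (_ + _%:~R *: _).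
by rewrite !intS; ring.
Qed.

Lemma gr_D_E_inj (k : int) v : k <= -2 -> gr k v -> D (E v) = 0 -> v = 0.
Proof.
move=> hk hv h0; have [s hs] := D_nilpotent v.
elim: s hs => // s ih hs; apply: ih.
have := iter_commDE s hv; rewrite h0 iter_linear0 hs linear0 add0r.
move/esym/eqP; rewrite scaler_eq0 intr_eq0 mulf_eq0 => /orP[|/eqP//].
by move=> h; exfalso; lia.
Qed.

Lemma gr_D_E_surj (k : int) v : k <= -2 -> gr k v ->
  exists2 w, gr k w & D (E w) = v.
Proof.
move=> hk; have [s] := D_nilpotent v.
elim: s v => [|s ih] v hs hv.
  by move: hs => /= ->; exists 0; rewrite ?linear0 //; case: (gr_subspace k).
pose c : K := (s.+1%:Z * (k - s%:Z + 1))%:~R.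
have c0 : c != 0 by rewrite /c intr_eq0 mulf_neq0 //; lia.
have hDE : gr k (D (E v)).
  rewrite (commDE hv); apply: subspaceD => //; last exact: subspaceZ.
  by apply: grE; apply: grD.
have [||w hw ew] := ih (v - c^-1 *: D (E v)).
- rewrite iter_linearBZ (iter_commDE s hv) hs linear0 add0r.
  by rewrite scalerA mulVf // scale1r subrr.
- by apply: subspaceB => //; apply: subspaceZ.
exists (w + c^-1 *: v); first by apply: subspaceD => //; apply: subspaceZ.
by rewrite !linearD !linearZ /= ew subrK.
Qed.

Lemma gr_direct_sum (k : int) : k <= 0 ->
  is_direct_sum (gr k) (fun v => gr k v /\ D v = 0) (image_of E (gr (k - 2))).
Proof.
move=> hk; have hk2 : k - 2 <= -2 by lia.
split=> [v|v [_ h0] [w hw ev]]; last first.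
  by rewrite ev in h0 *; rewrite (gr_D_E_inj hk2 hw h0) linear0.
split=> [hv|[u [_ [[hu _] [[w hw ->] ->]]]]]; last first.
  by apply: subspaceD => //; apply: grE.
have [w hw ew] := gr_D_E_surj hk2 (grD hv).
exists (v - E w), (E w); split; last by split; [exists w | rewrite subrK].
by split; [apply: subspaceB => //; apply: grE | rewrite linearB /= ew subrr].
Qed.

End LoweringRaising.

Lemma sum_nat_neq0 (I : finType) (P : pred I) (F : I -> nat) :
  (\sum_(i | P i) F i != 0)%N -> exists2 i, P i & (0 < F i)%N.
Proof.
rewrite sum_nat_eq0 => h.
have [/existsP [j /andP[]]|] := boolP [exists i, P i && (0 < F i)%N].
  by exists j.
rewrite negb_exists => /forallP h'; case/negP: h; apply/forallP => i.
by apply/implyP => Pi; move: (h' i); rewrite Pi -eqn0Ngt.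
Qed.

Lemma mnm_subK N (a : 'X_{1..N}) (i : 'I_N) : (0 < a i)%N ->
  (a - U_(i) + U_(i))%MM = a.
Proof.
move=> h; rewrite submK //; apply/mnm_lepP => j; rewrite mnm1E.
by case: eqP => [<-|].
Qed.

Section MpolyCoefficients.
Context {R : comNzRingType} {N : nat}.
Implicit Types (p : {mpoly R[N]}) (i j : 'I_N) (a b : 'X_{1..N}).

Lemma mcoeffXM i p a :
  ('X_i * p)@_a = if (0 < a i)%N then p@_(a - U_(i)) else 0.
Proof.
rewrite mulrC; case: ltnP => [h|].
  by rewrite -{1}(mnm_subK h) addmC mcoeffMX.
rewrite leqn0 => /eqP h; apply/eqP; rewrite mcoeff_eq0; apply/negP.
rewrite (perm_mem (msuppMX _ _)) => /mapP[b _ e].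
by move: h; rewrite e mnmDE mnm1E eqxx.
Qed.

Lemma mderivXi i j : 'X_j^`M(i) = (i == j)%:R :> {mpoly R[N]}.
Proof.
rewrite mderivX mnm1E eq_sym; case: eqP => [->|_]; last by rewrite scale0r.
by rewrite -[X in (X - _)%MM]add0m addmK mpolyX0 scale1r.
Qed.

End MpolyCoefficients.

(** * The Fischer form *)

Section FischerForm.
Context {K : numFieldType} {N : nat}.
Variable sgn : 'I_N -> K.
Local Notation A := {mpoly K[N]}.
Implicit Types (f g : A) (i j : 'I_N) (a b : 'X_{1..N}).

Definition fischer_weight a : K := \prod_i ((a i)`!%:R * sgn i ^+ a i).

Definition fischer f g : K :=
  \sum_(a <- msupp f) fischer_weight a * f@_a * g@_a.

Lemma fischer_widen (s : seq 'X_{1..N}) f g : uniq s ->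
  {subset msupp f <= s} ->
  fischer f g = \sum_(a <- s) fischer_weight a * f@_a * g@_a.
Proof.
move=> us sub; rewrite [RHS](bigID (mem (msupp f))) /=.
rewrite [X in _ + X]big1 ?addr0; last first.
  by move=> a; rewrite -mcoeff_eq0 => /eqP->; rewrite mulr0 mul0r.
rewrite -big_filter; apply: perm_big; apply: uniq_perm; rewrite ?filter_uniq //.
move=> a; rewrite mem_filter /=; case: (boolP (_ \in _)) => //= h.
by rewrite (sub _ h).
Qed.

Lemma fischerC f g : fischer f g = fischer g f.
Proof.
pose s := undup (msupp f ++ msupp g).
rewrite !(@fischer_widen s) ?undup_uniq // => [|a ha|a ha].
- by apply: eq_bigr => a _; rewrite mulrAC.
- by rewrite mem_undup mem_cat ha orbT.
- by rewrite mem_undup mem_cat ha.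
Qed.

Lemma fischer_is_linear f : linear_for *%R (fischer f).
Proof.
move=> c g h; rewrite /fischer mulr_sumr -big_split; apply: eq_bigr => a _ /=.
by rewrite mcoeffD mcoeffZ; ring.
Qed.
HB.instance Definition _ f :=
  GRing.isLinear.Build K A K _ (fischer f) (fischer_is_linear f).

Lemma fischerZl c f g : fischer (c *: f) g = c * fischer f g.
Proof. by rewrite fischerC linearZ /= fischerC. Qed.

Lemma fischerDl f1 f2 g : fischer (f1 + f2) g = fischer f1 g + fischer f2 g.
Proof. by rewrite fischerC linearD /= 2![fischer g _]fischerC. Qed.

Lemma fischerNl f g : fischer (- f) g = - fischer f g.
Proof. by rewrite fischerC linearN /= fischerC. Qed.

Lemma fischer_suml (I : Type) (r : seq I) (F : I -> A) g :
  fischer (\sum_(i <- r) F i) g = \sum_(i <- r) fischer (F i) g.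
Proof.
by rewrite fischerC linear_sum; apply: eq_bigr => i _; apply: fischerC.
Qed.

Lemma fischerX a g : fischer 'X_[a] g = fischer_weight a * g@_a.
Proof. by rewrite /fischer msuppX big_seq1 mcoeffX eqxx mulr1. Qed.

Lemma fischer_weightD a i : fischer_weight (a + U_(i))%MM =
  (a i).+1%:R * sgn i * fischer_weight a.
Proof.
rewrite /fischer_weight (bigD1 i) //= [in RHS](bigD1 i) //= mnmDE mnm1E eqxx.
rewrite addn1 factS natrM exprS.
have -> : \prod_(j | j != i)
    (((a + U_(i))%MM j)`!%:R * sgn j ^+ (a + U_(i))%MM j)
  = \prod_(j | j != i) ((a j)`!%:R * sgn j ^+ a j) :> K.
  by apply: eq_bigr => j hj; rewrite mnmDE mnm1E eq_sym (negPf hj) addn0.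
ring.
Qed.

Hypothesis sgn_sqr : forall i, sgn i * sgn i = 1.

Lemma fischer_weight_neq0 a : fischer_weight a != 0.
Proof.
rewrite prodf_seq_neq0; apply/allP => i _ /=; apply: mulf_neq0.
  by rewrite pnatr_eq0 -lt0n fact_gt0.
rewrite expf_neq0 //; apply/eqP => h.
by move: (sgn_sqr i); rewrite h mul0r => /esym/eqP; rewrite oner_eq0.
Qed.

Lemma fischer_mulX i f g : fischer ('X_i * f) g = sgn i * fischer f g^`M(i).
Proof.
elim/mpolyind: f => [|c a f _ _ ih].
  by rewrite mulr0 -[0](scale0r 0) !fischerZl !mul0r mulr0.
rewrite mulrDr -scalerAr !fischerDl !fischerZl ih mulrDr -mpolyXD !fischerX.
rewrite mcoeff_deriv [(U_(i) + a)%MM]addmC fischer_weightD -mulr_natl; ring.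
Qed.

Lemma fischer_deriv i f g : fischer f^`M(i) g = sgn i * fischer f ('X_i * g).
Proof.
by rewrite [fischer f _]fischerC fischer_mulX mulrA sgn_sqr mul1r fischerC.
Qed.

End FischerForm.

(** * Creation and annihilation operators *)

Section Oscillators.
Context {K : numFieldType} {N : nat}.
Variable T : {set 'I_N}.
Local Notation A := {mpoly K[N]}.
Implicit Types (f g : A) (i j : 'I_N) (a b : 'X_{1..N}) (k : int).

Definition cre i f : A := if i \in T then f^`M(i) else 'X_i * f.
Definition ann i f : A := if i \in T then - ('X_i * f) else f^`M(i).

Lemma cre_is_linear i : linear (cre i).
Proof.
move=> c f g; rewrite /cre; case: ifP => _; first by rewrite linearP.
by rewrite mulrDr -scalerAr.
Qed.
HB.instance Definition _ i :=
  GRing.isLinear.Build K A A _ (cre i) (cre_is_linear i).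

Lemma ann_is_linear i : linear (ann i).
Proof.
move=> c f g; rewrite /ann; case: ifP => _; last by rewrite linearP.
by rewrite mulrDr -scalerAr opprD scalerN.
Qed.
HB.instance Definition _ i :=
  GRing.isLinear.Build K A A _ (ann i) (ann_is_linear i).

Lemma creC i j f : cre i (cre j f) = cre j (cre i f).
Proof.
rewrite /cre; case: ifP => hi; case: ifP => hj.
- exact: mderiv_comm.
- by rewrite mderivM mderivXi; case: eqP hi hj => [->->//|];
    rewrite mul0r add0r.
- by rewrite mderivM mderivXi; case: eqP hi hj => [->->//|];
    rewrite mul0r add0r.
- by rewrite mulrCA.
Qed.

Lemma annC i j f : ann i (ann j f) = ann j (ann i f).
Proof.
rewrite /ann; case: ifP => hi; case: ifP => hj.
- by rewrite !mulrN mulrCA.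
- by rewrite linearN /= mderivM mderivXi; case: eqP hi hj => [->->//|];
    rewrite mul0r add0r.
- by rewrite linearN /= mderivM mderivXi; case: eqP hi hj => [->->//|];
    rewrite mul0r add0r.
- exact: mderiv_comm.
Qed.

Lemma ann_cre i j f : ann i (cre j f) = cre j (ann i f) + (i == j)%:R *: f.
Proof.
rewrite /ann /cre; case: ifP => hi; case: ifP => hj.
- rewrite linearN /= mderivM mderivXi eq_sym opprD addrAC.
  by case: eqP => _;
    rewrite ?mul1r ?scale1r ?addNr ?mul0r ?scale0r ?oppr0 ?add0r ?addr0.
- case: eqP hi hj => [->->//|_ _ _]; rewrite scale0r addr0.
  by rewrite mulrN mulrCA.
- case: eqP hi hj => [->->//|_ _ _]; rewrite scale0r addr0.
  by rewrite mderiv_comm.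
- rewrite mderivM mderivXi addrC.
  by case: eqP => _; rewrite ?mul1r ?scale1r ?mul0r ?scale0r.
Qed.

Lemma osc_unitE i j f : osc_unit T i j f = cre i (ann j f).
Proof.
rewrite /osc_unit /cre /ann; case hi: (i \in T); case hj: (j \in T) => //.
- rewrite linearN /= mderivM mderivXi opprD addrC.
  by case: eqP => _; rewrite ?mul1r ?scale1r ?mul0r ?scale0r.
- by rewrite mulrN mulrA.
Qed.

Lemma osc_repE (M : 'M_N) f :
  osc_rep T M f = \sum_i \sum_j M i j *: cre i (ann j f).
Proof.
by apply: eq_bigr => i _; apply: eq_bigr => j _; rewrite osc_unitE.
Qed.

Lemma osc_repD (M1 M2 : 'M_N) f :
  osc_rep T (M1 + M2) f = osc_rep T M1 f + osc_rep T M2 f.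
Proof.
rewrite -big_split; apply: eq_bigr => i _; rewrite -big_split.
by apply: eq_bigr => j _; rewrite mxE scalerDl.
Qed.

Lemma osc_repZ c (M : 'M_N) f : osc_rep T (c *: M) f = c *: osc_rep T M f.
Proof.
rewrite scaler_sumr; apply: eq_bigr => i _; rewrite scaler_sumr.
by apply: eq_bigr => j _; rewrite mxE scalerA.
Qed.

Lemma osc_rep0 f : osc_rep T 0 f = 0.
Proof. by rewrite -[0](scale0r 0) osc_repZ scale0r. Qed.

Lemma osc_repB (M1 M2 : 'M_N) f :
  osc_rep T (M1 - M2) f = osc_rep T M1 f - osc_rep T M2 f.
Proof. by rewrite -scaleN1r osc_repD osc_repZ scaleN1r. Qed.

Lemma osc_rep_delta i j f : osc_rep T (delta_mx i j) f = cre i (ann j f).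
Proof.
rewrite osc_repE (bigD1 i) //= (bigD1 j) //= mxE !eqxx scale1r.
rewrite !big1 ?addr0 // => [i' /negPf hi|j' /negPf hj].
  by apply: big1 => j' _; rewrite mxE hi scale0r.
by rewrite mxE hj andbF scale0r.
Qed.

Lemma osc_degreeE a :
  osc_degree T a = \sum_i (if i \in T then - (a i)%:Z else (a i)%:Z).
Proof.
rewrite /osc_degree [RHS](bigID (mem T)) /= addrC -sumrN; congr (_ + _).
  by apply: eq_big => [i|i]; rewrite ?inE // => /negPf->.
by apply: eq_bigr => i ->.
Qed.

Lemma osc_degreeD a b :
  osc_degree T (a + b)%MM = osc_degree T a + osc_degree T b.
Proof.
rewrite !osc_degreeE -big_split; apply: eq_bigr => i _; rewrite mnmDE PoszD.
by case: ifP => _; rewrite ?opprD.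
Qed.

Lemma osc_degreeU i : osc_degree T U_(i)%MM = if i \in T then -1 else 1.
Proof.
rewrite osc_degreeE (bigD1 i) //= mnm1E eqxx big1 ?addr0 // => j hj.
by rewrite mnm1E eq_sym (negPf hj) oppr0 if_same.
Qed.

Lemma osc_gradedP k f :
  osc_graded T k f <-> (forall a, f@_a != 0 -> osc_degree T a = k).
Proof.
split=> [[s [c [hs ->]]] a|hf]; last first.
  exists (msupp f), (fun a => f@_a); split; last exact: mpolyE.
  by apply/allP => a; rewrite mcoeff_msupp => /hf->.
rewrite raddf_sum /=; apply: contra_neq_eq => ha.
rewrite big1_seq // => b /= hb.
rewrite mcoeffZ mcoeffX; case: eqP => [e|_]; last exact: mulr0.
by move/allP: hs => /(_ _ hb)/eqP; rewrite e => /eqP; rewrite (negPf ha).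
Qed.

Lemma osc_graded_subspace k : is_subspace (osc_graded (K := K) T k).
Proof.
split=> [|c f g /osc_gradedP hf /osc_gradedP hg]; apply/osc_gradedP => a.
  by rewrite mcoeff0 eqxx.
rewrite mcoeffD mcoeffZ; have [f0|/hf//] := eqVneq (f@_a) 0.
by rewrite f0 mulr0 add0r => /hg.
Qed.

Lemma osc_graded_mulX k i f : osc_graded T k f ->
  osc_graded T (k + (if i \in T then -1 else 1)) ('X_i * f).
Proof.
move/osc_gradedP=> hf; apply/osc_gradedP => a; rewrite mcoeffXM.
case: ltnP => [h /hf <-|]; last by rewrite eqxx.
by rewrite -osc_degreeU -osc_degreeD mnm_subK.
Qed.

Lemma osc_graded_deriv k i f : osc_graded T k f ->
  osc_graded T (k - (if i \in T then -1 else 1)) f^`M(i).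
Proof.
move/osc_gradedP=> hf; apply/osc_gradedP => a; rewrite mcoeff_deriv.
rewrite mulrn_eq0 negb_or /= => /hf <-.
by rewrite -osc_degreeU osc_degreeD addrK.
Qed.

Lemma osc_graded_cre k i f :
  osc_graded T k f -> osc_graded T (k + 1) (cre i f).
Proof.
by rewrite /cre => hf; case: ifP => hi; [have := osc_graded_deriv i hf|
  have := osc_graded_mulX i hf]; rewrite hi ?opprK.
Qed.

Lemma osc_graded_ann k i f :
  osc_graded T k f -> osc_graded T (k - 1) (ann i f).
Proof.
rewrite /ann => hf; case: ifP => hi; last first.
  by have := osc_graded_deriv i hf; rewrite hi.
apply: subspaceN; first exact: osc_graded_subspace.
by have := osc_graded_mulX i hf; rewrite hi.
Qed.

Lemma cre_ann_mpolyX i a : cre i (ann i 'X_[a]) =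
  (if i \in T then - (a i).+1%:R else (a i)%:R) *: ('X_[a] : A).
Proof.
rewrite /cre /ann; case: ifP => hi; rewrite hi.
  rewrite linearN /= -mpolyXD mderivX mnmDE mnm1E eqxx add1n scaleNr.
  by rewrite addmC addmK.
rewrite mderivX -scalerAr; case: (posnP (a i)) => [->|h].
  by rewrite !scale0r.
by congr (_ *: _); rewrite -mpolyXD addmC mnm_subK.
Qed.

Lemma euler_osc k f : osc_graded T k f ->
  \sum_i cre i (ann i f) = (k - #|T|%:Z)%:~R *: f.
Proof.
move/osc_gradedP => hf; rewrite [f in LHS]mpolyE.
under eq_bigr => i _ do rewrite !linear_sum /=.
rewrite exchange_big [f in RHS]mpolyE scaler_sumr.
apply: eq_big_seq => a; rewrite mcoeff_msupp => /hf ea.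
under eq_bigr => i _ do rewrite !linearZ /= cre_ann_mpolyX.
rewrite -scaler_sumr -scaler_suml scalerA scalerA mulrC; congr (_ * _ *: _).
rewrite -ea osc_degreeE -natz -sumr_const [X in _ - X]big_mkcond -sumrB.
rewrite rmorph_sum; apply: eq_bigr => i _ /=; case: ifP => _.
  by rewrite rmorphB rmorphN /= -natr1 opprD.
by rewrite subr0.
Qed.

Variables (star : 'I_N -> 'I_N) (osc_sgn : 'I_N -> K).
Hypothesis starK : involutive star.
Hypothesis star_disjoint : forall i, i \in T -> star i \notin T.
Hypothesis osc_sgn_sqr : forall i, osc_sgn i * osc_sgn i = 1.
Hypothesis osc_sgn_star : forall i, osc_sgn (star i) = - osc_sgn i.
Local Notation gr := (osc_graded (K := K) T).

(* The operators Delta and eta of the statement, see [lower_ix], [raise_ix]. *)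
Definition lower f : A := 2^-1 *: \sum_i ann i (ann (star i) f).
Definition raise f : A := 2^-1 *: \sum_i cre i (cre (star i) f).

Lemma half_double f : 2^-1 *: (f + f) = f.
Proof. by rewrite -mulr2n -scaler_nat scalerA mulVf ?scale1r // pnatr_eq0. Qed.

Lemma lower_is_linear : linear lower.
Proof.
move=> c f g; rewrite /lower.
under eq_bigr => i _ do rewrite !linearP.
by rewrite big_split /= -scaler_sumr scalerDr !scalerA mulrC.
Qed.
HB.instance Definition _ := GRing.isLinear.Build K A A _ lower lower_is_linear.

Lemma raise_is_linear : linear raise.
Proof.
move=> c f g; rewrite /raise.
under eq_bigr => i _ do rewrite !linearP.
by rewrite big_split /= -scaler_sumr scalerDr !scalerA mulrC.
Qed.
HB.instance Definition _ := GRing.isLinear.Build K A A _ raise raise_is_linear.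

Lemma sum_delta (F : 'I_N -> A) j : \sum_i (i == j)%:R *: F i = F j.
Proof.
rewrite (bigD1 j) //= eqxx scale1r big1 ?addr0 // => i /negPf->.
by rewrite scale0r.
Qed.

Lemma sum_star (F : 'I_N -> A) : \sum_i F (star i) = \sum_i F i.
Proof. by rewrite [RHS](reindex_inj (inv_inj starK)). Qed.

Lemma lower_ann j f : lower (ann j f) = ann j (lower f).
Proof.
rewrite /lower linearZ /= [ann j (\sum_(_ <- _) _)]linear_sum; congr (_ *: _).
apply: eq_bigr => i _ /=; by rewrite [ann (star i) _]annC annC.
Qed.

Lemma lower_cre j f : lower (cre j f) = cre j (lower f) + ann (star j) f.
Proof.
rewrite /lower linearZ /= [cre j (\sum_(_ <- _) _)]linear_sum /=.
rewrite -[ann (star j) f]half_double -scalerDr; congr (_ *: _).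
rewrite -{1}(sum_delta (fun i => ann (star i) f) j).
rewrite -[ann (star j) f](sum_delta (fun i => ann i f)) -!big_split.
apply: eq_bigr => i _ /=.
rewrite ann_cre linearD linearZ /= ann_cre -addrA; congr (_ + (_ + _%:R *: _)).
by rewrite (inv_eq starK).
Qed.

Lemma lower_raise k f : gr k f ->
  lower (raise f) = raise (lower f) + ((k - #|T|%:Z)%:~R + N%:R / 2) *: f.
Proof.
move=> hf; rewrite {1}/raise linearZ /= [lower (\sum_(_ <- _) _)]linear_sum /=.
have e i : lower (cre i (cre (star i) f)) = cre i (cre (star i) (lower f))
    + (cre i (ann i f) + (cre (star i) (ann (star i) f) + f)).
  rewrite !lower_cre linearD /= starK ann_cre eqxx scale1r -!addrA.
  by congr (_ + _); rewrite addrC -addrA addrC.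
under eq_bigr => i _ do rewrite e.
rewrite !big_split /= (sum_star (fun i => cre i (ann i f))) (euler_osc hf).
rewrite sumr_const card_ord -scaler_nat !scalerDr addrA -addrA; congr (_ + _).
rewrite !scalerA addrA -[X in X + _]scalerDl -scalerDl; congr (_ *: _).
by field.
Qed.

Definition skew i j f : A := cre i (ann j f) - cre (star j) (ann (star i) f).

Lemma skew_is_linear i j : linear (skew i j).
Proof. by move=> c f g; rewrite /skew !linearP addrACA -scalerDr. Qed.
HB.instance Definition _ i j :=
  GRing.isLinear.Build K A A _ (skew i j) (skew_is_linear i j).

Definition skew_mx i j : 'M[K]_N := delta_mx i j - delta_mx (star j) (star i).

Lemma osc_rep_skew_mx i j f : osc_rep T (skew_mx i j) f = skew i j f.
Proof. by rewrite osc_repB !osc_rep_delta. Qed.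

Lemma lower_skew i j f : lower (skew i j f) = skew i j (lower f).
Proof.
rewrite /skew linearB /= !lower_cre !lower_ann starK [ann (star i) _]annC.
by rewrite opprD addrACA subrr addr0.
Qed.

Lemma skew_graded k i j f : gr k f -> gr k (skew i j f).
Proof.
have h i' j' : gr k f -> gr k (cre i' (ann j' f)).
  by move=> hf; rewrite -[k](subrK 1); apply/osc_graded_cre/osc_graded_ann.
move=> hf; rewrite /skew.
by apply: subspaceB; [apply: osc_graded_subspace | apply: h | apply: h].
Qed.

Lemma lower_graded k f : gr k f -> gr (k - 2) (lower f).
Proof.
move=> hf; have sg := osc_graded_subspace (k - 2).
apply: subspaceZ => //; apply: subspace_sum => // i _.
have -> : k - 2 = k - 1 - 1 by ring.
by do 2!apply: osc_graded_ann.
Qed.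

Lemma raise_graded k f : gr (k - 2) f -> gr k (raise f).
Proof.
move=> hf; have sg := osc_graded_subspace k.
apply: subspaceZ => //; apply: subspace_sum => // i _.
have -> : k = k - 2 + 1 + 1 by ring.
by do 2!apply: osc_graded_cre.
Qed.

Definition bounded_S (d : nat) f : Prop :=
  forall a, f@_a != 0 -> (\sum_(i | i \notin T) a i < d)%N.

Lemma bounded_S_subspace d : is_subspace (bounded_S d).
Proof.
split=> [|c f g hf hg] a; first by rewrite mcoeff0 eqxx.
rewrite mcoeffD mcoeffZ; have [f0|/hf//] := eqVneq (f@_a) 0.
by rewrite f0 mulr0 add0r => /hg.
Qed.

Lemma bounded_S_deriv d i f : i \notin T ->
  bounded_S d.+1 f -> bounded_S d f^`M(i).
Proof.
move=> hi hf a; rewrite mcoeff_deriv mulrn_eq0 negb_or /= => /hf.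
by rewrite (bigD1 i) //= [X in _ -> (X < _)%N](bigD1 i) //= mnmDE mnm1E eqxx
  addn1 addSn ltnS; under eq_bigr => j hj do
  rewrite mnmDE mnm1E eq_sym (negPf (proj2 (andP hj))) addn0.
Qed.

Lemma bounded_S_mulX d i f : i \in T -> bounded_S d f -> bounded_S d ('X_i * f).
Proof.
move=> hi hf a; rewrite mcoeffXM; case: ifP => [_ /hf|_]; last by rewrite eqxx.
apply: leq_ltn_trans; apply: eq_leq; apply: eq_bigr => j hj.
rewrite mnmBE mnm1E; case: eqP => [e|]; last by rewrite subn0.
by rewrite -e hi in hj.
Qed.

Lemma bounded_S_ann d i f : bounded_S d f -> bounded_S d (ann i f).
Proof.
move=> hf; rewrite /ann; case: ifP => hi.
  by apply: (subspaceN (bounded_S_subspace d)); apply: bounded_S_mulX.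
apply: bounded_S_deriv; first by rewrite hi.
by move=> a /hf /leqW.
Qed.

Lemma bounded_S_annS d i f : i \notin T ->
  bounded_S d.+1 f -> bounded_S d (ann i f).
Proof.
by move=> hi hf; rewrite /ann (negPf hi); apply: bounded_S_deriv.
Qed.

Lemma bounded_S_lower d f : bounded_S d.+1 f -> bounded_S d (lower f).
Proof.
move=> hf; apply: (subspaceZ _ (bounded_S_subspace d)).
apply: (subspace_sum _ (bounded_S_subspace d)) => i _.
have [hi|hi] := boolP (i \in T).
  exact/bounded_S_ann/bounded_S_annS/hf/star_disjoint.
exact/bounded_S_annS/bounded_S_ann.
Qed.

Lemma lower_nilpotent f : exists s, iter s lower f = 0.
Proof.
have [d hd] : exists d, bounded_S d f.
  exists (\sum_(a <- msupp f) (\sum_(i | i \notin T) a i).+1)%N => a.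
  rewrite -mcoeff_msupp => ha; rewrite (bigD1_seq a) ?msupp_uniq //=.
  exact: leq_addr.
exists d; elim: d f hd => [|d ih] f hd.
  apply/mpolyP => a; rewrite mcoeff0; apply: contraTeq isT => ha.
  by have := hd _ ha; rewrite ltn0.
by rewrite iterSr; apply/ih/bounded_S_lower.
Qed.

Definition harmonic k f : Prop := gr k f /\ lower f = 0.

Lemma harmonic_subspace k : is_subspace (harmonic k).
Proof.
split=> [|c f g [hf f0] [hg g0]].
  by split; [case: (osc_graded_subspace k) | rewrite linear0].
split; last by rewrite linearP /= f0 g0 scaler0 addr0.
by case: (osc_graded_subspace k) => _; apply.
Qed.

Lemma harmonic_skew k i j f : harmonic k f -> harmonic k (skew i j f).
Proof.
case=> hf f0; split; first exact: skew_graded.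
by rewrite lower_skew f0 linear0.
Qed.

(* With these signs the form makes [cre i] and [ann i] adjoint to each other up
   to [osc_sgn i], whether or not [i] lies in [T]. *)
Definition fischer_sgn i : K := if i \in T then - osc_sgn i else osc_sgn i.
Local Notation form := (fischer fischer_sgn).

Lemma fischer_sgn_sqr i : fischer_sgn i * fischer_sgn i = 1.
Proof.
by rewrite /fischer_sgn; case: ifP => _; rewrite ?mulrNN osc_sgn_sqr.
Qed.

Lemma fischer_cre i f g : form (cre i f) g = osc_sgn i * form f (ann i g).
Proof.
rewrite /cre /ann; case: ifP => hi.
  rewrite (fischer_deriv fischer_sgn_sqr) /fischer_sgn hi linearN /= mulrN.
  by rewrite mulNr.
by rewrite fischer_mulX /fischer_sgn hi.
Qed.

Lemma fischer_ann i f g : form (ann i f) g = osc_sgn i * form f (cre i g).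
Proof.
rewrite [form f _]fischerC fischer_cre mulrA osc_sgn_sqr mul1r.
exact: fischerC.
Qed.

Lemma fischer_skew i j f g :
  form (skew i j f) g = osc_sgn i * osc_sgn j * form f (skew j i g).
Proof.
rewrite /skew fischerDl fischerNl !fischer_cre !fischer_ann linearB /=.
by rewrite !osc_sgn_star; ring.
Qed.

Lemma fischer_lower f g : form (lower f) g = - form f (raise g).
Proof.
rewrite /lower /raise fischerZl fischer_suml linearZ linear_sum /=.
rewrite -mulrN -sumrN; congr (_ * _); apply: eq_bigr => i _.
rewrite !fischer_ann osc_sgn_star creC.
by rewrite mulNr mulrN mulrA osc_sgn_sqr mul1r.
Qed.

Lemma harmonic_nondegenerate k f :
  is_direct_sum (gr k) (harmonic k) (image_of raise (gr (k - 2))) ->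
  harmonic k f -> (forall h, harmonic k h -> form f h = 0) -> f = 0.
Proof.
case=> hsum _ [hf f0] orth.
apply/mpolyP => a; rewrite mcoeff0; apply/eqP; apply: contraT => ha.
have /hsum[h [_ [hh [[g _ ->] e]]]] : gr k 'X_[a].
  apply/osc_gradedP => b; rewrite mcoeffX; have [<- _|_] := eqVneq a b.
    by move/osc_gradedP: hf; apply.
  by rewrite eqxx.
have : form f 'X_[a] = 0.
  rewrite e linearD /= orth // add0r; apply/eqP.
  by rewrite -oppr_eq0 -fischer_lower f0 -[0](scale0r 0) fischerZl mul0r.
rewrite fischerC fischerX => /eqP.
by rewrite mulf_eq0 (negPf ha) (negPf (fischer_weight_neq0 fischer_sgn_sqr a)).
Qed.

Definition skew_symmetric (M : 'M[K]_N) : Prop :=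
  forall i j, M (star j) (star i) = - M i j.

Lemma osc_rep_skew M f : skew_symmetric M ->
  osc_rep T M f = 2^-1 *: \sum_i \sum_j M i j *: skew i j f.
Proof.
move=> hM; rewrite osc_repE -[LHS]half_double; congr (_ *: _).
have e : \sum_i \sum_j M i j *: cre (star j) (ann (star i) f) =
    - \sum_i \sum_j M i j *: cre i (ann j f).
  rewrite exchange_big -sum_star /= -sumrN; apply: eq_bigr => i _.
  rewrite -sum_star -sumrN; apply: eq_bigr => j _.
  by rewrite !starK hM scaleNr.
rewrite -[X in _ + X]opprK -e -sumrN -big_split; apply: eq_bigr => i _ /=.
rewrite -sumrN -big_split; apply: eq_bigr => j _ /=.
by rewrite /skew scalerBr.
Qed.

Section Submodules.
Variable g : {vspace 'M[K]_N}.
Hypothesis g_skew : forall M, M \in g -> skew_symmetric M.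
Hypothesis skew_mx_g : forall i j, skew_mx i j \in g.
Local Notation rho := (osc_rep T).

Lemma submodule_skew (U : A -> Prop) i j f :
  is_submodule g rho U -> U f -> U (skew i j f).
Proof. by case=> _ hU Uf; rewrite -osc_rep_skew_mx; apply: hU. Qed.

Lemma skew_submodule (U : A -> Prop) : is_subspace U ->
  (forall i j f, U f -> U (skew i j f)) -> is_submodule g rho U.
Proof.
move=> sU hU; split=> // M f /g_skew hM Uf; rewrite (osc_rep_skew _ hM).
apply: subspaceZ => //; apply: subspace_sum => // i _.
by apply: subspace_sum => // j _; apply: subspaceZ => //; apply: hU.
Qed.

Lemma harmonic_submodule k : is_submodule g rho (harmonic k).
Proof.
by apply: skew_submodule => [|i j f]; [apply: harmonic_subspace |
  apply: harmonic_skew].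
Qed.

Lemma harmonic_irreducible k v :
  is_direct_sum (gr k) (harmonic k) (image_of raise (gr (k - 2))) ->
  v != 0 -> generated_by g rho (harmonic k) v ->
  (forall U : A -> Prop, is_submodule g rho U ->
    (forall f, U f -> harmonic k f) -> (exists2 u, U u & form u v != 0) ->
    U v) ->
  is_irreducible g rho (harmonic k).
Proof.
move=> hsum v0 [hH Hv gen] hv; split=> //; first by exists v.
move=> U hU UH; have [/hv Uv|noU] := classic (exists2 u, U u & form u v != 0).
  by right; apply: gen => //; apply: Uv.
left=> u Uu; apply: (harmonic_nondegenerate hsum (UH _ Uu)).
have orth : forall h, harmonic k h -> forall w, U w -> form w h = 0.
  pose P h := harmonic k h /\ forall w, U w -> form w h = 0.
  suff hP : is_submodule g rho P.
    move=> h Hh; apply: (gen _ hP _ _ Hh).2; split=> // w Uw.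
    by apply/eqP; apply: contra_notT noU => hw; exists w.
  apply: skew_submodule => [|i j f [Hf hf]].
    have sH := harmonic_subspace k.
    split=> [|c f1 f2 [H1 h1] [H2 h2]].
      by split=> [|w _]; [case: sH | rewrite linear0].
    split=> [|w Uw]; first by case: sH => _; apply.
    by rewrite linearP /= h1 // h2 // mulr0 addr0.
  split=> [|w Uw]; first exact: harmonic_skew.
  have := fischer_skew j i w f; rewrite hf; last exact: submodule_skew.
  move=> /esym/eqP; rewrite mulf_eq0 => /orP[/eqP h|/eqP//].
  have := osc_sgn_sqr j; have := osc_sgn_sqr i.
  move: h; set a := osc_sgn j; set b := osc_sgn i => h hb ha.
  have : (a * b) * (a * b) = 1 by rewrite mulrACA ha hb mulr1.
  by rewrite h mul0r => /esym/eqP; rewrite oner_eq0.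
by move=> h Hh; apply: orth.
Qed.

End Submodules.
End Oscillators.

(** * The even orthogonal algebra *)

Section Indices.
Context {n : nat} (hn : (2 <= n)%N).
Local Notation ix := (ix hn).

Lemma ix_ord (i : 'I_(2 * n)) : ix i.+1 = i.
Proof. by apply: val_inj; rewrite /= ixE //=; case: i => /= i; lia. Qed.

Lemma ix_last : ix (2 * n) = ix (n + n).
Proof. by congr (Defs.ix hn); lia. Qed.

Variant ix_spec : 'I_(2 * n) -> Prop :=
  | IxLow i of (1 <= i <= n)%N : ix_spec (ix i)
  | IxHigh i of (1 <= i <= n)%N : ix_spec (ix (n + i)).

Lemma ixP a : ix_spec a.
Proof.
rewrite -(ix_ord a); have := ltn_ord a; case: (ltnP a n) => h1 h2.
  by constructor; lia.
have -> : (a.+1 = n + (a.+1 - n))%N by lia.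
by constructor; lia.
Qed.

Lemma big_ix (T : Type) (idx : T) (op : Monoid.com_law idx)
    (F : 'I_(2 * n) -> T) :
  \big[op/idx]_i F i = op (\big[op/idx]_(1 <= i < n.+1) F (ix i))
                          (\big[op/idx]_(1 <= i < n.+1) F (ix (n + i))).
Proof.
transitivity (\big[op/idx]_(0 <= i < 2 * n) F (ix i.+1)).
  by rewrite big_mkord; apply: eq_bigr => i _; rewrite ix_ord.
rewrite (big_cat_nat (n := n)) //; last by lia.
rewrite !big_add1 /=; congr (op _ _).
rewrite -{1}[n]add0n big_addn; have -> : (2 * n - n = n)%N by lia.
by apply: eq_bigr => i _; rewrite addnS addnC.
Qed.

Definition star (a : 'I_(2 * n)) : 'I_(2 * n) :=
  ix (if (a < n)%N then n + a.+1 else a.+1 - n)%N.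

Lemma star_low i : (1 <= i <= n)%N -> star (ix i) = ix (n + i).
Proof.
move=> hi; rewrite /star ixE; last by lia.
by rewrite ifT; [congr ix; lia | lia].
Qed.

Lemma star_high i : (1 <= i <= n)%N -> star (ix (n + i)) = ix i.
Proof.
move=> hi; rewrite /star ixE; last by lia.
by rewrite ifF; [congr ix; lia | lia].
Qed.

Lemma starK : involutive star.
Proof.
by move=> a; case: (ixP a) => i hi;
  [rewrite star_low // star_high | rewrite star_high // star_low].
Qed.

Lemma ix_low_T i : (1 <= i <= n)%N -> (ix i \in osc_T n) = (i < n)%N.
Proof. by move=> hi; rewrite inE ixE; lia. Qed.

Lemma ix_high_T i : (1 <= i <= n)%N -> (ix (n + i) \in osc_T n) = false.
Proof. by move=> hi; rewrite inE ixE; lia. Qed.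

Lemma star_disjoint a : a \in osc_T n -> star a \notin osc_T n.
Proof.
by case: (ixP a) => i hi; rewrite ?(star_low hi) ix_high_T.
Qed.

Lemma card_osc_T : #|osc_T n| = n.-1.
Proof.
rewrite -sum1_card big_mkcond big_ix /=.
rewrite [X in (_ + X)%N]big_nat [X in (_ + X)%N]big1 => [|i hi]; last first.
  by rewrite ix_high_T.
rewrite addn0 big_nat_recr /=; last by lia.
rewrite ix_low_T ?ltnn ?addn0; last by lia.
rewrite big_nat (eq_bigr (fun=> 1%N)) => [|i hi]; last first.
  by rewrite ix_low_T; [rewrite ifT |]; lia.
by rewrite -big_nat sum_nat_const_nat; lia.
Qed.

End Indices.

Section IndexedOperators.
Context {K : numFieldType} {n : nat} (hn : (2 <= n)%N).
Local Notation ix := (ix hn).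
Local Notation star := (star hn).
Local Notation A := {mpoly K[2 * n]}.
Local Notation Delta := (lower (K := K) (osc_T n) star).
Local Notation eta := (raise (K := K) (osc_T n) star).

Lemma half_sum_ix (F : 'I_(2 * n) -> A) : (forall a, F (star a) = F a) ->
  2^-1 *: \sum_a F a = \sum_(1 <= i < n.+1) F (ix i).
Proof.
move=> hF; rewrite big_ix /=.
have -> : \sum_(1 <= i < n.+1) F (ix (n + i)) = \sum_(1 <= i < n.+1) F (ix i).
  by rewrite !big_nat; apply: eq_bigr => i hi; rewrite -[RHS]hF star_low.
exact: half_double.
Qed.

Lemma lower_ix (f : A) : Delta f =
  - (\sum_(1 <= i < n) 'X_(ix i) * f^`M(ix (n + i)))
    + f^`M(ix (2 * n))^`M(ix n).
Proof.
rewrite /lower half_sum_ix => [|a]; last by rewrite starK annC.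
have n0 : (1 <= n <= n)%N by lia.
rewrite big_nat_recr /=; last by lia.
rewrite -sumrN; congr (_ + _).
  rewrite !big_nat; apply: eq_bigr => i hi.
  have h : (1 <= i <= n)%N by lia.
  rewrite (star_low hn h) /ann (ix_low_T hn h) (ix_high_T hn h).
  by have [_ ->] := andP hi.
rewrite (star_low hn n0) /ann (ix_low_T hn n0) (ix_high_T hn n0) ltnn.
by rewrite ix_last.
Qed.

Lemma raise_ix (f : A) : eta f =
  \sum_(1 <= i < n) 'X_(ix (n + i)) * f^`M(ix i)
    + 'X_(ix n) * 'X_(ix (2 * n)) * f.
Proof.
rewrite /raise half_sum_ix => [|a]; last by rewrite starK creC.
have n0 : (1 <= n <= n)%N by lia.
rewrite big_nat_recr /=; last by lia.
congr (_ + _).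
  rewrite !big_nat; apply: eq_bigr => i hi.
  have h : (1 <= i <= n)%N by lia.
  rewrite (star_low hn h) creC /cre (ix_low_T hn h) (ix_high_T hn h).
  by have [_ ->] := andP hi.
rewrite (star_low hn n0) /cre (ix_low_T hn n0) (ix_high_T hn n0) ltnn -mulrA.
by rewrite ix_last.
Qed.

End IndexedOperators.

Section OrthogonalAlgebra.
Context {R : realType} {n : nat} (hn : (2 <= n)%N).
Local Notation C := R[i].
Local Notation ix := (ix hn).
Local Notation star := (star hn).
Local Notation "'E_ ( i , j )" :=
  (delta_mx (ix i) (ix j) : 'M[C]_(2 * n)) (format "''E_' ( i ,  j )").
Local Notation A := {mpoly C[2 * n]}.
Local Notation Delta := (lower (K := C) (osc_T n) star).
Local Notation eta := (raise (K := C) (osc_T n) star).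
Local Notation gen := (skew_mx (K := C) star).

Lemma so_DeltaE (f : A) : so_Delta hn f = Delta f.
Proof. by rewrite lower_ix. Qed.

Lemma so_etaE (f : A) : so_eta hn f = eta f.
Proof. by rewrite raise_ix. Qed.

Lemma so_harmonicE k (f : A) :
  so_harmonic R hn k f = harmonic (K := C) (osc_T n) star k f.
Proof. by rewrite /so_harmonic so_DeltaE. Qed.

Lemma skew_mx_star a b : gen (star b) (star a) = - gen a b.
Proof. by rewrite /skew_mx !starK opprB. Qed.

Lemma skew_mx_skew a b : skew_symmetric star (gen a b).
Proof.
move=> i j; rewrite !mxE.
have e u v : (star u == v) = (u == star v) by rewrite (inv_eq (starK hn)).
by rewrite !e !starK opprB [(j == _) && _]andbC [(j == _) && _]andbC.
Qed.

Lemma skew_symmetric_ind (I : Type) (r : seq I) (Q : pred I)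
    (U : I -> {vspace 'M[C]_(2 * n)}) :
  (forall i, Q i -> forall M, M \in U i -> skew_symmetric star M) ->
  forall M, M \in (\sum_(i <- r | Q i) U i)%VS -> skew_symmetric star M.
Proof.
apply: memv_big_add_ind => [i j|M1 M2 h1 h2 i j].
  by rewrite !mxE oppr0.
by rewrite !mxE h1 h2 opprD.
Qed.

Lemma so_even_skew M : M \in so_even R hn -> skew_symmetric star M.
Proof.
have line a b : forall M, M \in <[gen a b]>%VS -> skew_symmetric star M.
  move=> _ /vlineP[c ->] i j; rewrite mxE [in RHS]mxE skew_mx_skew.
  exact: mulrN.
move=> /memv_addP[M1 h1 [M2 h2 ->]] i j; rewrite !mxE opprD; congr (_ + _).
  move: M1 h1 i j; rewrite big_nat; apply: skew_symmetric_ind => i hi.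
  rewrite big_nat; apply: skew_symmetric_ind => j hj.
  by rewrite -(star_low hn (i := i)) -?(star_low hn (i := j)) //; apply: line.
move: M2 h2 i j; rewrite big_nat; apply: skew_symmetric_ind => i hi.
rewrite big_nat; apply: skew_symmetric_ind => j hj ?.
move=> /memv_addP[M3 h3 [M4 h4 ->]].
have hj' : (1 <= j <= n)%N by lia.
have /line h3' : M3 \in <[gen (ix i) (ix (n + j))]>%VS.
  by rewrite /skew_mx star_high // star_low.
have /line h4' : M4 \in <[gen (ix (n + j)) (ix i)]>%VS.
  by rewrite /skew_mx star_high // star_low.
by move=> a b; rewrite !mxE h3' h4' opprD.
Qed.

Lemma memv_big_add (I : eqType) (r : seq I) (U : I -> {vspace 'M[C]_(2 * n)})
    i M : uniq r -> i \in r -> M \in U i -> M \in (\sum_(i <- r) U i)%VS.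
Proof.
move=> ur ir; rewrite (bigD1_seq i) //=.
exact/subvP/addvSl.
Qed.

Lemma skew_mx_so_even a b : gen a b \in so_even R hn.
Proof.
have ll i j : (1 <= i <= n)%N -> (1 <= j <= n)%N ->
    gen (ix i) (ix j) \in so_even R hn.
  move=> hi hj; rewrite /skew_mx !star_low //.
  apply: (subvP (addvSl _ _)).
  apply: (@memv_big_add _ _ _ i); rewrite ?iota_uniq ?mem_index_iota //.
  apply: (@memv_big_add _ _ _ j); rewrite ?iota_uniq ?mem_index_iota //.
  exact: memv_line.
have lt i j : (1 <= i < j)%N -> (j <= n)%N ->
    gen (ix i) (ix (n + j)) \in so_even R hn /\
    gen (ix (n + j)) (ix i) \in so_even R hn.
  move=> hi hj; have h1 : (1 <= i <= n)%N by lia.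
  have h2 : (1 <= j <= n)%N by lia.
  rewrite /skew_mx star_high // star_low //.
  have sub M : M \in (<['E_(i, (n + j)%N) - 'E_(j, (n + i)%N)]> +
       <['E_((n + j)%N, i) - 'E_((n + i)%N, j)]>)%VS -> M \in so_even R hn.
    move=> hM; apply: (subvP (addvSr _ _)).
    apply: (@memv_big_add _ _ _ i); rewrite ?iota_uniq ?mem_index_iota //.
    apply: (@memv_big_add _ _ _ j); rewrite ?iota_uniq ?mem_index_iota //.
    by lia.
  split; apply: sub.
    exact/(subvP (addvSl _ _))/memv_line.
  exact/(subvP (addvSr _ _))/memv_line.
have st c d : gen (star d) (star c) \in so_even R hn ->
    gen c d \in so_even R hn.
  by rewrite skew_mx_star memvN.
have lh i j : (1 <= i <= n)%N -> (1 <= j <= n)%N ->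
    gen (ix i) (ix (n + j)) \in so_even R hn /\
    gen (ix (n + j)) (ix i) \in so_even R hn.
  move=> hi hj; case: (ltngtP i j) => hij.
  - by apply: lt; lia.
  - have [||h1 h2] := lt j i; try lia.
    by split; apply: st; rewrite star_high // star_low.
  - by rewrite -hij /skew_mx star_high // star_low // !subrr mem0v.
case: (ixP hn a) => i hi; case: (ixP hn b) => j hj.
- exact: ll.
- by case: (lh _ _ hi hj).
- by case: (lh _ _ hj hi).
- by apply: st; rewrite !star_high //; apply: ll.
Qed.

End OrthogonalAlgebra.

(** * The basis of the harmonic polynomials *)

Section HarmonicBasis.
Context {K : numFieldType} {n : nat} (hn : (2 <= n)%N).
Local Notation m := n.-1.
Local Notation star := (star hn).
Local Notation A := {mpoly K[2 * n]}.
Local Notation Delta := (lower (K := K) (osc_T n) star).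
Local Notation gr := (osc_graded (K := K) (osc_T n)).
Local Notation Harm := (harmonic (K := K) (osc_T n) star).
Implicit Types (a b c : 'X_{1..2 * n}) (f : A) (i j : 'I_m).

Definition ixT i : 'I_(2 * n) := ix hn i.+1.
Definition ixS i : 'I_(2 * n) := ix hn (n + i.+1).
Definition ixp : 'I_(2 * n) := ix hn n.
Definition ixq : 'I_(2 * n) := ix hn (2 * n).

Lemma ixT_val i : ixT i = i :> nat.
Proof. by rewrite /ixT ixE //=; case: i => /= i; lia. Qed.

Lemma ixS_val i : ixS i = (n + i)%N :> nat.
Proof. by rewrite /ixS ixE; case: i => /= i; lia. Qed.

Lemma ixp_val : ixp = m :> nat.
Proof. by rewrite /ixp ixE //; lia. Qed.

Lemma ixq_val : ixq = (2 * n).-1 :> nat.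
Proof. by rewrite /ixq ixE //; lia. Qed.

Lemma ixT_eq i j : (ixT i == ixT j) = (i == j).
Proof. by rewrite -val_eqE /= !ixT_val. Qed.

Lemma ixS_eq i j : (ixS i == ixS j) = (i == j).
Proof. by rewrite -val_eqE /= !ixS_val eqn_add2l. Qed.

Lemma ixTS_eq i j : (ixT i == ixS j) = false.
Proof. by rewrite -val_eqE /= ixT_val ixS_val; case: i => /= i; lia. Qed.

Lemma ixTp_eq i : (ixT i == ixp) = false.
Proof. by rewrite -val_eqE /= ixT_val ixp_val; case: i => /= i; lia. Qed.

Lemma ixTq_eq i : (ixT i == ixq) = false.
Proof. by rewrite -val_eqE /= ixT_val ixq_val; case: i => /= i; lia. Qed.

Lemma ixSp_eq i : (ixS i == ixp) = false.
Proof. by rewrite -val_eqE /= ixS_val ixp_val; case: i => /= i; lia. Qed.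

Lemma ixSq_eq i : (ixS i == ixq) = false.
Proof. by rewrite -val_eqE /= ixS_val ixq_val; case: i => /= i; lia. Qed.

Lemma ixpq_eq : (ixp == ixq) = false.
Proof. by rewrite -val_eqE /= ixp_val ixq_val; lia. Qed.

Definition ix_eqE :=
  (eqxx, ixT_eq, ixS_eq, ixTS_eq, ixTp_eq, ixTq_eq, ixSp_eq, ixSq_eq, ixpq_eq,
   (fun i j => etrans (eq_sym (ixS j) (ixT i)) (ixTS_eq i j)),
   (fun i => etrans (eq_sym ixp (ixT i)) (ixTp_eq i)),
   (fun i => etrans (eq_sym ixq (ixT i)) (ixTq_eq i)),
   (fun i => etrans (eq_sym ixp (ixS i)) (ixSp_eq i)),
   (fun i => etrans (eq_sym ixq (ixS i)) (ixSq_eq i)),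
   etrans (eq_sym ixq ixp) ixpq_eq).

Variant ix4_spec : 'I_(2 * n) -> Prop :=
  | IxT i : ix4_spec (ixT i)
  | IxS i : ix4_spec (ixS i)
  | Ixp : ix4_spec ixp
  | Ixq : ix4_spec ixq.

Lemma ix4P u : ix4_spec u.
Proof.
have hord (i : nat) : (1 <= i < n)%N -> (i.-1 < m)%N by lia.
case: (ixP hn u) => i hi; case: (ltnP i n) => h.
- have h1 : (1 <= i < n)%N by lia.
  have -> : ix hn i = ixT (Ordinal (hord i h1)).
    by congr (ix hn); rewrite /=; lia.
  exact: IxT.
- have -> : i = n by lia.
  exact: Ixp.
- have h1 : (1 <= i < n)%N by lia.
  have -> : ix hn (n + i) = ixS (Ordinal (hord i h1)).
    by congr (ix hn); rewrite /=; lia.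
  exact: IxS.
- have -> : i = n by lia.
  by rewrite -ix_last; apply: Ixq.
Qed.

Lemma big_ix4 (V : Type) (idx : V) (op : Monoid.com_law idx)
    (F : 'I_(2 * n) -> V) :
  \big[op/idx]_u F u =
    op (op (F ixp) (F ixq)) (\big[op/idx]_(i < m) op (F (ixT i)) (F (ixS i))).
Proof.
have n0 : (1 <= n)%N by lia.
rewrite (big_ix hn) !big_nat_recr //= !big_add1 !big_mkord big_split /=.
by rewrite -ix_last Monoid.mulmACA Monoid.mulmC.
Qed.

Lemma ixT_T i : ixT i \in osc_T n.
Proof. by rewrite inE ixT_val; case: i => /= i; lia. Qed.

Lemma ixS_T i : ixS i \in osc_T n = false.
Proof. by rewrite inE ixS_val; case: i => /= i; lia. Qed.

Lemma ixp_T : ixp \in osc_T n = false.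
Proof. by rewrite inE ixp_val; lia. Qed.

Lemma ixq_T : ixq \in osc_T n = false.
Proof. by rewrite inE ixq_val; lia. Qed.

Lemma star_ixT i : star (ixT i) = ixS i.
Proof. by rewrite star_low //; case: i => /= i; lia. Qed.

Lemma star_ixp : star ixp = ixq.
Proof. by rewrite /ixq ix_last star_low //; lia. Qed.

Lemma star_ixq : star ixq = ixp.
Proof. by rewrite -star_ixp starK. Qed.

Lemma Delta_ix4 f : Delta f =
  f^`M(ixq)^`M(ixp) - \sum_(i < m) 'X_(ixT i) * f^`M(ixS i).
Proof. by rewrite lower_ix big_add1 big_mkord addrC. Qed.

Lemma osc_degree_ix4 a : osc_degree (osc_T n) a =
  (a ixp)%:Z + (a ixq)%:Z + \sum_(i < m) ((a (ixS i))%:Z - (a (ixT i))%:Z).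
Proof.
rewrite osc_degreeE big_ix4 ixp_T ixq_T; congr (_ + _).
by apply: eq_bigr => i _; rewrite ixT_T ixS_T addrC.
Qed.

Lemma harmonic_eq0 f : Delta f = 0 ->
  (forall a, (a ixp * a ixq)%N = 0%N -> f@_a = 0) -> f = 0.
Proof.
move=> f0 hf; apply/mpolyP => a; rewrite mcoeff0.
move: {2}(a ixp) (erefl (a ixp)) => t; elim: t a => [|t ih] a ha.
  by apply: hf; rewrite ha.
have [a0|a0] := posnP (a ixq); first by apply: hf; rewrite a0 muln0.
pose c := (a - U_(ixp) - U_(ixq))%MM.
have ac : (c + U_(ixp) + U_(ixq))%MM = a.
  apply/mnmP => u; rewrite /c !mnmDE !mnmBE !mnm1E.
  case: (ix4P u) => [i|i||]; rewrite !ix_eqE; lia.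
have : (Delta f)@_c = 0 by rewrite f0 mcoeff0.
rewrite Delta_ix4 mcoeffB !mcoeff_deriv ac raddf_sum big1 => [|i _].
  rewrite subr0 => /eqP; rewrite !mulrn_eq0 => /orP[//|/orP[//|/eqP//]].
rewrite /= mcoeffXM mcoeff_deriv; case: ifP => // _; rewrite ih ?mul0rn //.
rewrite /c !(mnmDE, mnmBE) !mnm1E !ix_eqE; lia.
Qed.

Definition ord_ext (r : 'I_m -> nat) (t : nat) : nat :=
  if insub t is Some i then r i else 0%N.

(* The exponent of the summand of index [r] in [harmonic_sum]. *)
Definition harmonic_mnm a (r : 'I_m -> nat) : 'X_{1..2 * n} :=
  [multinom if (u < m)%N then (a u + ord_ext r u)%N
            else if (u == ixp) || (u == ixq) then (a u + \sum_i r i)%N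
            else (a u - ord_ext r (u - n))%N | u < 2 * n].

Lemma ord_ext_val r i : ord_ext r i = r i.
Proof. by rewrite /ord_ext valK. Qed.

Lemma harmonic_mnmT a r i : harmonic_mnm a r (ixT i) = (a (ixT i) + r i)%N.
Proof. by rewrite mnmE ixT_val ltn_ord ord_ext_val. Qed.

Lemma harmonic_mnmS a r i : harmonic_mnm a r (ixS i) = (a (ixS i) - r i)%N.
Proof.
rewrite mnmE ifF ?ix_eqE /= ixS_val; last by lia.
by rewrite addKn ord_ext_val.
Qed.

Lemma harmonic_mnmp a r : harmonic_mnm a r ixp = (a ixp + \sum_i r i)%N.
Proof. by rewrite mnmE ifF ?ix_eqE // ixp_val ltnn. Qed.

Lemma harmonic_mnmq a r : harmonic_mnm a r ixq = (a ixq + \sum_i r i)%N.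
Proof. by rewrite mnmE ifF ?ix_eqE ?orbT // ixq_val; lia. Qed.

Definition harmonic_mnmE :=
  (harmonic_mnmT, harmonic_mnmS, harmonic_mnmp, harmonic_mnmq).

Definition harmonic_coef a (r : 'I_m -> nat) : K :=
  ((a ixp)`! * (a ixq)`! * (\prod_i 'C(a (ixS i), r i)) * (\sum_i r i)`!)%:R
  / ((a ixp + \sum_i r i)`! * (a ixq + \sum_i r i)`!)%:R.

Local Notation natf r := (fun i : 'I_m => nat_of_ord (r i)).

Definition harmonic_family a : A :=
  \sum_(r : {ffun 'I_m -> 'I_(mdeg a).+1})
    harmonic_coef a (natf r) *: 'X_[harmonic_mnm a (natf r)].

Lemma harmonic_coef_bin a r i : harmonic_coef a r != 0 -> (r i <= a (ixS i))%N.
Proof.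
apply: contraNT; rewrite -ltnNge => h.
by rewrite /harmonic_coef (bigD1 i) //= (bin_small h) mul0n muln0 mul0n mul0r.
Qed.

Lemma osc_degree_harmonic_mnm a r : (forall i, (r i <= a (ixS i))%N) ->
  osc_degree (osc_T n) (harmonic_mnm a r) = osc_degree (osc_T n) a.
Proof.
move=> hr; rewrite !osc_degree_ix4 !harmonic_mnmE !PoszD.
have -> : \sum_(i < m) ((harmonic_mnm a r (ixS i))%:Z
      - (harmonic_mnm a r (ixT i))%:Z) =
    \sum_(i < m) ((a (ixS i))%:Z - (a (ixT i))%:Z) - (\sum_i r i)%N%:Z *+ 2.
  rewrite -natz natr_sum -sumrMnl -sumrB; apply: eq_bigr => i _.
  by rewrite !harmonic_mnmE -subzn // PoszD natz; ring.
ring.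
Qed.

Lemma harmonic_family_graded a :
  gr (osc_degree (osc_T n) a) (harmonic_family a).
Proof.
have sg := osc_graded_subspace (K := K) (osc_T n) (osc_degree (osc_T n) a).
apply: subspace_sum => // r _.
have [->|/harmonic_coef_bin h] := eqVneq (harmonic_coef a (natf r)) 0.
  by rewrite scale0r; case: sg.
apply: subspaceZ => //; apply/osc_gradedP => b; rewrite mcoeffX.
have [<- _|_] := eqVneq (harmonic_mnm a (natf r)) b; last by rewrite eqxx.
exact: osc_degree_harmonic_mnm.
Qed.

Lemma harmonic_mnm0 a (r : 'I_m -> nat) : (forall i, r i = 0%N) ->
  harmonic_mnm a r = a.
Proof.
move=> r0; have s0 : (\sum_i r i = 0)%N by apply: big1.
by apply/mnmP => u; case: (ix4P u) => [i|i||];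
  rewrite harmonic_mnmE ?s0 ?r0 ?addn0 ?subn0.
Qed.

Lemma harmonic_coef0 a (r : 'I_m -> nat) : (forall i, r i = 0%N) ->
  harmonic_coef a r = 1.
Proof.
move=> r0; have s0 : (\sum_i r i = 0)%N by apply: big1.
rewrite /harmonic_coef s0 !addn0 fact0 muln1 big1 ?muln1 => [|i _].
  by rewrite divff // pnatr_eq0 -lt0n muln_gt0 !fact_gt0.
by rewrite r0 bin0.
Qed.

Lemma mcoeff_harmonic_family_neq0 a b : (harmonic_family a)@_b != 0 ->
  exists s, b ixp = (a ixp + s)%N /\ b ixq = (a ixq + s)%N.
Proof.
move=> h; apply: NNPP => no; move: h; rewrite raddf_sum /= big1 ?eqxx // => r _.
rewrite mcoeffZ mcoeffX; case: eqP => [e|_]; last exact: mulr0.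
by case: no; exists (\sum_i r i)%N; rewrite -e !harmonic_mnmE.
Qed.

Lemma harmonic_family_mpolyX a : (forall i, a (ixS i) = 0%N) ->
  harmonic_family a = 'X_[a].
Proof.
move=> ha; rewrite /harmonic_family (bigD1 [ffun=> ord0]) //= big1.
  rewrite harmonic_coef0 ?harmonic_mnm0 ?scale1r ?addr0 // => i;
    by rewrite ffunE.
move=> r hr.
have [->|/harmonic_coef_bin h] := eqVneq (harmonic_coef a (natf r)) 0.
  exact: scale0r.
case/eqP: hr; apply/ffunP => i; apply/val_inj/eqP; rewrite ffunE /= -leqn0.
by rewrite (leq_trans (h i)) ?ha.
Qed.

Lemma mcoeff_harmonic_family a b :
  (a ixp * a ixq)%N = 0%N -> (b ixp * b ixq)%N = 0%N ->
  (harmonic_family a)@_b = (a == b)%:R.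
Proof.
move=> ha hb; rewrite /harmonic_family raddf_sum /= (bigD1 [ffun=> ord0]) //=.
rewrite mcoeffZ mcoeffX big1 ?addr0 => [|r hr].
  by rewrite harmonic_coef0 ?harmonic_mnm0 ?mul1r // => i; rewrite ffunE.
rewrite mcoeffZ mcoeffX; case: eqP => [e|_]; last by rewrite mulr0.
have s1 : (0 < \sum_i r i)%N.
  rewrite lt0n sum_nat_eq0; apply: contraNN hr => /forallP h.
  by apply/eqP/ffunP => i; apply/val_inj/eqP; rewrite ffunE /= (implyP (h i)).
by move: hb; rewrite -e !harmonic_mnmE; nia.
Qed.

Definition incr_at (i : 'I_m) (r : 'I_m -> nat) : 'I_m -> nat :=
  fun j => (r j + (j == i))%N.

Lemma sum_incr_at i r : (\sum_j incr_at i r j = (\sum_j r j).+1)%N.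
Proof.
rewrite big_split /= -[RHS]addn1; congr addn.
by rewrite (bigD1 i) //= eqxx big1 // => j /negPf->.
Qed.

Lemma harmonic_mnm_incr a r i : (r i < a (ixS i))%N ->
  (U_(ixT i) + (harmonic_mnm a r - U_(ixS i)))%MM =
  (harmonic_mnm a (incr_at i r) - U_(ixq) - U_(ixp))%MM.
Proof.
move=> hr; apply/mnmP => u; case: (ix4P u) => [j|j||];
  rewrite !(mnmDE, mnmBE) !mnm1E !harmonic_mnmE ?sum_incr_at !ix_eqE /incr_at;
  rewrite ?[i == j]eq_sym; lia.
Qed.

Lemma bin_incr_at a r i : (r i < a (ixS i))%N ->
  ((r i).+1 * \prod_j 'C(a (ixS j), incr_at i r j) =
   (a (ixS i) - r i) * \prod_j 'C(a (ixS j), r j))%N.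
Proof.
move=> hr; rewrite (bigD1 i) //= [in RHS](bigD1 i) //= !mulnA.
rewrite /incr_at eqxx addn1.
rewrite mul_bin_left; congr (_ * _)%N; apply: eq_bigr => j /negPf->.
by rewrite addn0.
Qed.

Lemma harmonic_coef_incr a r i : (r i < a (ixS i))%N ->
  let s := (\sum_j r j).+1 in
  (incr_at i r i)%:R * (harmonic_coef a (incr_at i r) * (a ixp + s)%:R
    * (a ixq + s)%:R / s%:R) = harmonic_coef a r * (a (ixS i) - r i)%:R.
Proof.
move=> hr s; rewrite /harmonic_coef sum_incr_at -/s !addnS !factS.
have f0 k : k`!%:R != 0 :> K by rewrite pnatr_eq0 -lt0n fact_gt0.
have := bin_incr_at hr; move/(congr1 (fun k => k%:R : K)).
rewrite /incr_at eqxx addn1 !natrM -/(incr_at i r).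
set P1 := (\prod_j _)%:R; set P2 := (\prod_j _)%:R => e.
have n0 k : k.+1%:R != 0 :> K by rewrite pnatr_eq0.
have key (x d A0 B0 S F A1 B1 SA SB : K) : x * P1 = d * P2 -> S != 0 ->
    A1 != 0 -> B1 != 0 -> SA != 0 -> SB != 0 ->
    x * (A0 * B0 * P1 * (S * F) / (SA * A1 * (SB * B1)) * SA * SB / S) =
    A0 * B0 * P2 * F / (A1 * B1) * d.
  move=> exd S0 A10 B10 SA0 SB0.
  transitivity (A0 * B0 * F / (A1 * B1) * (x * P1)).
    by field; rewrite ?S0 ?A10 ?B10 ?SA0 ?SB0.
  by rewrite exd; field; rewrite ?A10 ?B10.
exact: key.
Qed.

Lemma harmonic_family_lower a : (a ixp * a ixq)%N = 0%N ->
  Delta (harmonic_family a) = 0.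
Proof.
move=> ha; rewrite Delta_ix4.
pose B := mdeg a; pose c r := harmonic_coef a r; pose M r := harmonic_mnm a r.
pose N r := (M r - U_(ixq) - U_(ixp))%MM.
(* [D r i] is the share of [r i] in the [sum_j r j] summands of
   [d_n d_(2n)] applied to the term of index [r]. *)
pose D r (i : 'I_m) : A := ((r i)%:R * (c r * (a ixp + \sum_j r j)%:R
  * (a ixq + \sum_j r j)%:R / (\sum_j r j)%:R)) *: 'X_[N r].
have dpq r : (c r *: 'X_[M r])^`M(ixq)^`M(ixp) = \sum_i D r i.
  rewrite /D -scaler_suml -mulr_suml -natr_sum !mderivZ mderivX mderivZ mderivX.
  rewrite !scalerA /M mnmBE mnm1E !ix_eqE subn0 !harmonic_mnmE; congr (_ *: _).
  have [s0|s0] := posnP (\sum_i r i)%N; last first.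
    have s0' : (\sum_i r i)%:R != 0 :> K by rewrite pnatr_eq0 -lt0n.
    by field.
  rewrite s0 !addn0 mul0r -mulrA -natrM mulnC ha.
  exact: mulr0.
pose sh i (r : {ffun 'I_m -> 'I_B.+1}) : {ffun 'I_m -> 'I_B.+1} :=
  [ffun j => if j == i then ordS (r j) else r j].
have sh_inj i : injective (sh i).
  move=> r1 r2 /ffunP e; apply/ffunP => j; move: (e j); rewrite !ffunE.
  by case: eqP => // _; apply: ordS_inj.
have dTS i (r : {ffun 'I_m -> 'I_B.+1}) :
    'X_(ixT i) * (c (natf r) *: 'X_[M (natf r)])^`M(ixS i) =
    D (natf (sh i r)) i.
  have aB : (a (ixS i) <= B)%N by rewrite /B mdegE (bigD1 (ixS i)) //= leq_addr.
  have [hr|hr] := ltnP (r i) (a (ixS i)).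
    have -> : natf (sh i r) = incr_at i (natf r).
      apply: functional_extensionality => j; rewrite ffunE /incr_at.
      case: eqP => [->|_] /=; last by rewrite addn0.
      by rewrite modn_small ?addn1 // ltnS (leq_trans hr).
    rewrite mderivZ mderivX /M harmonic_mnmS -!scalerAr -mpolyXD scalerA.
    rewrite harmonic_mnm_incr // /D /N /M sum_incr_at.
    by rewrite (harmonic_coef_incr (r := natf r)).
  rewrite mderivZ mderivX /M harmonic_mnmS.
  have -> : (a (ixS i) - r i = 0)%N by lia.
  rewrite scale0r scaler0 mulr0 /D.
  have [->|] := eqVneq (c (natf (sh i r))) 0.
    by rewrite !mul0r mulr0 scale0r.
  move/harmonic_coef_bin => /(_ i); rewrite ffunE eqxx /=.
  have [rB|rB] := ltnP (r i) B.
    by rewrite modn_small ?ltnS // => h; exfalso; lia.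
  have -> : r i = B :> nat by have := ltn_ord (r i); lia.
  by rewrite modnn mul0r scale0r.
have -> : (harmonic_family a)^`M(ixq)^`M(ixp) =
    \sum_(r : {ffun 'I_m -> 'I_B.+1}) \sum_i D (natf r) i.
  rewrite /harmonic_family (linear_sum (mderiv ixq)) (linear_sum (mderiv ixp)).
  by apply: eq_bigr => r _; apply: dpq.
rewrite exchange_big /= -sumrB big1 // => i _; apply/eqP; rewrite subr_eq0.
apply/eqP; rewrite /harmonic_family (linear_sum (mderiv (ixS i))) mulr_sumr.
rewrite (reindex_inj (sh_inj i)).
by apply: eq_bigr => r _; rewrite dTS.
Qed.

Lemma harmonic_family_harmonic a : (a ixp * a ixq)%N = 0%N ->
  Harm (osc_degree (osc_T n) a) (harmonic_family a).
Proof.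
move=> ha; split; first exact: harmonic_family_graded.
exact: harmonic_family_lower.
Qed.

Definition free_mnm a : bool := (a ixp * a ixq == 0)%N.

Lemma harmonic_expand k f : Harm k f ->
  f = \sum_(a <- msupp f | free_mnm a) f@_a *: harmonic_family a.
Proof.
case=> hf f0; apply/eqP; rewrite -subr_eq0; apply/eqP/harmonic_eq0.
  rewrite linearB /= f0 linear_sum big1 ?subr0 // => a /eqP ha.
  by rewrite linearZ /= harmonic_family_lower ?scaler0.
move=> b hb; rewrite mcoeffB raddf_sum /=.
have [bf|bf] := boolP (b \in msupp f); last first.
  rewrite big1_seq ?subr0 => [|a /andP[/eqP ha af]].
    by apply/eqP; rewrite mcoeff_eq0.
  rewrite mcoeffZ mcoeff_harmonic_family //.
  case: eqP => [e|_]; last exact: mulr0.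
  by rewrite -e af in bf.
rewrite -big_filter (bigD1_seq b) ?filter_uniq ?msupp_uniq //=; last first.
  by rewrite mem_filter bf andbT; apply/eqP.
rewrite mcoeffZ mcoeff_harmonic_family // eqxx mulr1 big_filter_cond.
rewrite big1 ?addr0 ?subrr //.
move=> a /andP[/eqP ha /negPf hab].
by rewrite mcoeffZ mcoeff_harmonic_family // hab mulr0.
Qed.

Lemma harmonic_family_basis k :
  is_basis (fun a => free_mnm a && (osc_degree (osc_T n) a == k))
    harmonic_family (Harm k).
Proof.
split=> [s c us /allP hs e a ha|f].
  have /andP[/eqP fa _] := hs _ ha.
  move/(congr1 (mcoeff a)): e; rewrite mcoeff0 raddf_sum (bigD1_seq a) //=.
  rewrite mcoeffZ mcoeff_harmonic_family // eqxx mulr1 big1_seq ?addr0 //.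
  move=> b /andP[/negPf hab /hs/andP[/eqP fb _]].
  by rewrite mcoeffZ mcoeff_harmonic_family // hab mulr0.
split=> [hf|[s [c [/allP hs ->]]]].
  exists [seq a <- msupp f | free_mnm a], (fun a => f@_a); split.
    apply/allP => a; rewrite mem_filter mcoeff_msupp => /andP[-> /=].
    by case: hf => /osc_gradedP hf _ /hf->.
  by rewrite big_filter; apply: harmonic_expand hf.
have sH := harmonic_subspace (K := K) (osc_T n) star k.
rewrite big_seq; apply: subspace_sum => // a /hs/andP[/eqP ha /eqP <-].
apply: subspaceZ (harmonic_family_harmonic ha).
exact: harmonic_subspace.
Qed.

End HarmonicBasis.

(** * Generation by the highest weight vector *)

Section Generation.
Context {K : numFieldType} {n : nat} (hn : (2 <= n)%N).
Local Notation m := n.-1.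
Local Notation star := (star hn).
Local Notation A := {mpoly K[2 * n]}.
Local Notation Delta := (lower (K := K) (osc_T n) star).
Local Notation Harm := (harmonic (K := K) (osc_T n) star).
Local Notation Skew := (skew (K := K) (osc_T n) star).
Local Notation xT := (ixT hn).
Local Notation xS := (ixS hn).
Local Notation p := (ixp hn).
Local Notation q := (ixq hn).
Local Notation F := (harmonic_family (K := K) hn).
Implicit Types (a b c : 'X_{1..2 * n}) (f : A) (i j : 'I_m).

(* [u] and [w] are the variables of indices [n] and [2n], in either order. *)
Variant middle_pair : 'I_(2 * n) -> 'I_(2 * n) -> Prop :=
  | MiddlePQ : middle_pair p q
  | MiddleQP : middle_pair q p.

Lemma skew_middle u w i f : middle_pair u w ->
  Skew w (xT i) f = - ('X_w * ('X_(xT i) * f)) - 'X_(xS i) * f^`M(u).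
Proof.
by case; rewrite /skew star_ixT ?star_ixp ?star_ixq /cre /ann ixT_T ixS_T
  ?ixp_T ?ixq_T mulrN.
Qed.

Lemma middle_free u w a : middle_pair u w ->
  free_mnm hn a = (a u * a w == 0)%N.
Proof. by case; rewrite /free_mnm // mulnC. Qed.

Lemma middle_eq u w i : middle_pair u w ->
  [/\ (u == w) = false, (w == u) = false, (xS i == u) = false,
      (xS i == w) = false & (xT i == u) = false].
Proof. by case; rewrite !ix_eqE. Qed.

Lemma middle_support u w a b : middle_pair u w -> (F a)@_b != 0 ->
  exists s, b u = (a u + s)%N /\ b w = (a w + s)%N.
Proof.
by case=> /mcoeff_harmonic_family_neq0[s [h1 h2]]; exists s; split.
Qed.

Lemma harmonic_ext k k' f g : Harm k f -> Harm k' g ->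
  (forall b, free_mnm hn b -> f@_b = g@_b) -> f = g.
Proof.
move=> [_ f0] [_ g0] e; apply/eqP; rewrite -subr_eq0; apply/eqP.
apply: (harmonic_eq0 (hn := hn)); first by rewrite linearB /= f0 g0 subrr.
by move=> b hb; rewrite mcoeffB e ?subrr // /free_mnm hb.
Qed.

Lemma skew_harmonic_family u w i a : middle_pair u w -> a w = 0%N ->
  Skew w (xT i) (F (a + U_(u))%MM) = - (a u).+1%:R *: F (a + U_(xS i))%MM.
Proof.
move=> uw aw; have [uw0 wu0 iu0 iw0 tu0] := middle_eq i uw.
have free_au : free_mnm hn (a + U_(u))%MM.
  by rewrite (middle_free _ uw) !mnmDE !mnm1E uw0 aw muln0.
have free_ai : free_mnm hn (a + U_(xS i))%MM.
  by rewrite (middle_free _ uw) !mnmDE !mnm1E iw0 aw muln0.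
pose d := osc_degree (osc_T n).
apply: (@harmonic_ext (d (a + U_(u))%MM) (d (a + U_(xS i))%MM)).
- apply: (harmonic_skew (@starK _ hn)).
  by apply: harmonic_family_harmonic; apply/eqP.
- apply: subspaceZ (harmonic_subspace _ _ _) _.
  by apply: harmonic_family_harmonic; apply/eqP.
move=> b free_b; rewrite (skew_middle _ _ uw) mcoeffB mcoeffN mcoeffZ.
rewrite mcoeff_harmonic_family; try exact/eqP.
have -> : ('X_w * ('X_(xT i) * F (a + U_(u))%MM))@_b = 0.
  rewrite mcoeffXM; case: posnP => // bw; rewrite mcoeffXM; case: ifP => // _.
  apply/eqP; apply: contraT => /(middle_support uw)[s [e _]].
  move: e; move: free_b; rewrite (middle_free _ uw) !mnmBE !mnmDE !mnm1E.
  by rewrite eqxx wu0; nia.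
rewrite oppr0 sub0r mulNr; congr (- _); rewrite mcoeffXM mcoeff_deriv.
case: posnP => bi.
  case: eqP => [e|_]; last by rewrite mulr0.
  by move: bi; rewrite -e mnmDE mnm1E eqxx addn1.
rewrite mnmBE mnm1E iu0 subn0.
set c := (b - U_(xS i) + U_(u))%MM.
have [fc|nfc] := boolP (free_mnm hn c).
  rewrite mcoeff_harmonic_family; try exact/eqP.
  have -> : (a + U_(u) == c)%MM = (a + U_(xS i) == b)%MM.
    rewrite -[in RHS](mnm_subK bi) /c ![(_ + U_(_))%MM]addmC.
    by rewrite !(inj_eq (@addmI _ _)).
  case: eqP => [e|_]; last by rewrite mul0rn mulr0.
  by rewrite -e mnmDE mnm1E iu0 addn0 mulr1.
have [->|/(middle_support uw)[s [e1 e2]]] := eqVneq ((F (a + U_(u))%MM)@_c) 0.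
  rewrite mul0rn; case: eqP => [e|_]; last by rewrite mulr0.
  case/negP: nfc; rewrite (middle_free _ uw) /c -e !(mnmDE, mnmBE) !mnm1E.
  by rewrite iw0 uw0 aw muln0.
exfalso; move: free_b nfc e1 e2; rewrite !(middle_free _ uw) /c !(mnmDE, mnmBE).
rewrite !mnm1E eqxx uw0 iu0 iw0 aw; nia.
Qed.

Lemma free_middle a : free_mnm hn a ->
  exists u w, middle_pair u w /\ a w = 0%N.
Proof.
rewrite /free_mnm muln_eq0 => /orP[] /eqP h.
  by exists q, p; split=> //; constructor.
by exists p, q; split=> //; constructor.
Qed.

Lemma skew_mulX u w i a : middle_pair u w -> a u = 0%N ->
  Skew w (xT i) 'X_[a] = - 'X_[(a + U_(xT i) + U_(w))%MM].
Proof.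
move=> uw au; rewrite (skew_middle _ _ uw) mderivX au scale0r mulr0 subr0.
by rewrite -!mpolyXD; congr (- 'X_[_]); rewrite [in RHS]addmC [in RHS](addmC a).
Qed.

Lemma skew_shift i j a : i != j -> (forall i', a (xS i') = 0%N) ->
  Skew (xT j) (xT i) 'X_[a + U_(xT j)] =
  - (a (xT j)).+1%:R *: 'X_[a + U_(xT i)].
Proof.
move=> ij aS; rewrite /skew !star_ixT /cre /ann !ixT_T !ixS_T.
rewrite mderivX mnmDE mnm1E !ix_eqE aS scale0r mulr0 subr0.
rewrite linearN /= -mpolyXD mderivX !mnmDE !mnm1E !ix_eqE (negPf ij) scaleNr.
rewrite add0n addn1; congr (- (_ *: 'X_[_])).
by rewrite addmA addmK addmC.
Qed.

Lemma osc_degree_T a : (forall i, a (xS i) = 0%N) ->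
  osc_degree (osc_T n) a =
    (a p + a q)%N%:Z - (\sum_(i < m) a (xT i))%N%:Z.
Proof.
move=> aS; rewrite (osc_degree_ix4 hn) PoszD; congr (_ + _).
rewrite -natz natr_sum -sumrN; apply: eq_bigr => i _.
by rewrite aS sub0r natz.
Qed.

Section Span.
Variables (k : int) (U : A -> Prop) (l : 'I_m).
Hypothesis k_le0 : k <= 0.
Hypothesis sU : is_subspace U.
Hypothesis U_skew : forall u w f, U f -> U (Skew u w f).
Hypothesis U_hwv : U 'X_[U_(xT l) *+ `|k|%N].

Lemma subspace_scaleI (c : K) f : c != 0 -> U (c *: f) -> U f.
Proof.
by move=> c0 /(subspaceZ c^-1 sU); rewrite scalerA mulVf // scale1r.
Qed.

Lemma span_T t a : (forall i, a (xS i) = 0%N) -> a p = 0%N -> a q = 0%N ->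
  osc_degree (osc_T n) a = k -> (t + a (xT l) = `|k|)%N -> U 'X_[a].
Proof.
elim: t a => [|t ih] a aS ap aq da ta.
  have sl : (\sum_(i < m | i != l) a (xT i) = 0)%N.
    move: da ta; rewrite osc_degree_T // ap aq (bigD1 l) //=.
    by move: (\sum_(i < m | _) _)%N => s; lia.
  have -> : a = (U_(xT l) *+ `|k|%N)%MM; last exact: U_hwv.
  apply/mnmP => u; rewrite mulmnE mnm1E.
  case: (ix4P hn u) => [i|i||]; rewrite !ix_eqE ?aS ?ap ?aq //.
  have [<-|il] := eqVneq l i; first by rewrite mul1n -ta.
  by move/eqP: sl; rewrite sum_nat_eq0 => /forallP/(_ i);
    rewrite eq_sym il => /eqP->.
have [i il ai] : exists2 i, i != l & (0 < a (xT i))%N.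
  have : (\sum_(i < m | i != l) a (xT i) != 0)%N.
    move: da ta; rewrite osc_degree_T // ap aq (bigD1 l) //=.
    by move: (\sum_(i < m | _) _)%N => s; lia.
  exact: sum_nat_neq0.
pose c := (a - U_(xT i))%MM.
have ac : a = (c + U_(xT i))%MM by rewrite mnm_subK.
have cS i' : c (xS i') = 0%N by rewrite mnmBE aS.
rewrite ac; apply: (@subspace_scaleI (- (c (xT l)).+1%:R)).
  by rewrite oppr_eq0 pnatr_eq0.
rewrite -skew_shift //; apply: U_skew; apply: ih.
- by move=> i'; rewrite mnmDE cS mnm1E !ix_eqE.
- by rewrite mnmDE mnmBE ap !mnm1E !ix_eqE.
- by rewrite mnmDE mnmBE aq !mnm1E !ix_eqE.
- by move: da; rewrite ac !osc_degreeD !osc_degreeU !ixT_T.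
- rewrite mnmDE mnmBE !mnm1E !ix_eqE (negPf il); lia.
Qed.

Lemma span_mpolyX u w t a : middle_pair u w -> (forall i, a (xS i) = 0%N) ->
  a w = 0%N -> a u = t -> osc_degree (osc_T n) a = k -> U 'X_[a].
Proof.
move=> uw; have hpq b : (b p + b q = b u + b w)%N by case: uw; rewrite // addnC.
have [uT wT] : u \in osc_T n = false /\ w \in osc_T n = false.
  by case: uw; rewrite ixp_T ixq_T.
elim: t a => [|t ih] a aS aw au da.
  have [ap aq] : a p = 0%N /\ a q = 0%N by have := hpq a; lia.
  have ak : (a (xT l) <= `|k|)%N.
    move: da; rewrite osc_degree_T // ap aq (bigD1 l) //=.
    by move: (\sum_(i < m | _) _)%N => s; lia.
  by apply: (@span_T (`|k| - a (xT l))%N) => //; lia.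
have [i _ ai] : exists2 i : 'I_m, true & (0 < a (xT i))%N.
  apply: sum_nat_neq0; move: da; rewrite osc_degree_T // hpq aw au.
  by move: (\sum_(i < m | _) _)%N => s; lia.
have [_ wu0 _ _ tu0] := middle_eq i uw.
have tw0 : (xT i == w) = false by case: uw; rewrite !ix_eqE.
pose c := (a - U_(xT i) - U_(u))%MM.
have ac : a = (c + U_(xT i) + U_(u))%MM.
  apply/mnmP => x; rewrite !(mnmDE, mnmBE) !mnm1E.
  case: (eqVneq (xT i) x) => [<-|_]; first by rewrite eq_sym tu0; lia.
  by case: (eqVneq u x) => [<-|_]; lia.
have cw : c w = 0%N by rewrite !mnmBE aw.
have wu : middle_pair w u by case: uw; constructor.
rewrite ac -[X in U X]opprK -(skew_mulX i wu cw); apply: subspaceN => //.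
apply: U_skew; apply: ih => //.
- by move=> i'; rewrite !mnmBE aS.
- by rewrite !mnmBE !mnm1E tu0 eqxx au; lia.
- by move: da; rewrite {1}ac !osc_degreeD !osc_degreeU ixT_T uT; lia.
Qed.

Lemma span_harmonic_family t a : free_mnm hn a ->
  osc_degree (osc_T n) a = k -> (\sum_(i < m) a (xS i) = t)%N -> U (F a).
Proof.
elim: t a => [|t ih] a fa da ta.
  have aS i : a (xS i) = 0%N.
    by apply/eqP; move/eqP: ta; rewrite sum_nat_eq0 => /forallP/(_ i).
  rewrite harmonic_family_mpolyX //; have [u [w [uw aw]]] := free_middle fa.
  exact: (span_mpolyX uw aS aw erefl).
have [i _ ai] : exists2 i : 'I_m, true & (0 < a (xS i))%N.
  by apply: sum_nat_neq0; rewrite ta.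
have [u [w [uw aw]]] := free_middle fa.
have [uw0 wu0 iu0 iw0 tu0] := middle_eq i uw.
have uT : u \in osc_T n = false by case: uw; rewrite ?ixp_T ?ixq_T.
pose c := (a - U_(xS i))%MM.
have ac : a = (c + U_(xS i))%MM by rewrite mnm_subK.
have cw : c w = 0%N by rewrite mnmBE aw.
rewrite ac; apply: (@subspace_scaleI (- (c u).+1%:R)).
  by rewrite oppr_eq0 pnatr_eq0.
rewrite -(skew_harmonic_family _ uw) //; apply: U_skew; apply: ih.
- by rewrite (middle_free _ uw) !mnmDE !mnm1E uw0 cw muln0.
- by move: da; rewrite ac !osc_degreeD !osc_degreeU ixS_T uT.
have e (j : 'I_m) : (a (xS j) = (c + U_(u))%MM (xS j) + (j == i))%N.
  rewrite ac !mnmDE !mnm1E ixS_eq [i == j]eq_sym.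
  by case: uw; rewrite ix_eqE addn0.
move: ta; under eq_bigr => j _ do rewrite e.
rewrite big_split /= [X in (_ + X)%N](bigD1 i) //= eqxx.
by rewrite [X in (_ + (_ + X))%N]big1 ?addn1 => [[]|j /negPf->].
Qed.

Lemma span_harmonic f : Harm k f -> U f.
Proof.
move=> hf; rewrite (harmonic_expand hf); apply: subspace_sum => // a fa.
have [->|ha] := eqVneq (f@_a) 0; first by rewrite scale0r; case: sU.
apply: subspaceZ => //; apply: span_harmonic_family => //.
by case: hf => /osc_gradedP hf _; apply: hf.
Qed.

End Span.
End Generation.

(** * Weights and irreducibility *)

Section Irreducibility.
Context {K : numFieldType} {n : nat} (hn : (2 <= n)%N).
Local Notation m := n.-1.
Local Notation star := (star hn).
Local Notation A := {mpoly K[2 * n]}.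
Local Notation Delta := (lower (K := K) (osc_T n) star).
Local Notation eta := (raise (K := K) (osc_T n) star).
Local Notation gr := (osc_graded (K := K) (osc_T n)).
Local Notation Harm := (harmonic (K := K) (osc_T n) star).
Local Notation Skew := (skew (K := K) (osc_T n) star).
Local Notation xT := (ixT hn).
Local Notation xS := (ixS hn).
Local Notation p := (ixp hn).
Local Notation q := (ixq hn).
Implicit Types (a b c : 'X_{1..2 * n}) (f : A) (i j : 'I_m).

Lemma harmonic_direct_sum (k : int) : k <= 0 ->
  is_direct_sum (gr k) (Harm k) (image_of eta (gr (k - 2))).
Proof.
apply: gr_direct_sum => [k'|k' f|k' f|k' f hf|f].
- exact: osc_graded_subspace.
- exact: lower_graded.
- exact: raise_graded.
- rewrite /= (lower_raise (@starK _ hn) hf) card_osc_T // natrM.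
  rewrite mulrAC divff ?pnatr_eq0 // mul1r -[n%:R]/(n%:Z%:~R) -intrD.
  by congr (_ + _%:~R *: _); lia.
- exact: lower_nilpotent (@star_disjoint _ hn) f.
Qed.

Definition cartan_weight (u : 'I_(2 * n)) a : K :=
  (if u \in osc_T n then - (a u).+1%:R else (a u)%:R)
  - (if star u \in osc_T n then - (a (star u)).+1%:R else (a (star u))%:R).

Lemma skew_diag_mpolyX u a : Skew u u 'X_[a] = cartan_weight u a *: 'X_[a].
Proof. by rewrite /skew !cre_ann_mpolyX -scalerBl. Qed.

Lemma mcoeff_skew_diag u f a : (Skew u u f)@_a = cartan_weight u a * f@_a.
Proof.
rewrite [f in LHS]mpolyE linear_sum raddf_sum.
rewrite [f in RHS]mpolyE raddf_sum mulr_sumr.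
apply: eq_bigr => b _ /=; rewrite linearZ /= skew_diag_mpolyX !mcoeffZ mcoeffX.
by case: eqP => [->|_]; rewrite ?mulr0 // !mulr1 mulrC.
Qed.

Lemma cartan_weightT i a :
  cartan_weight (xT i) a = - (a (xT i) + a (xS i)).+1%:R.
Proof.
by rewrite /cartan_weight star_ixT ixT_T ixS_T -opprD -natrD addSn.
Qed.

Lemma cartan_weightp a : cartan_weight p a = (a p)%:R - (a q)%:R.
Proof. by rewrite /cartan_weight star_ixp ixp_T ixq_T. Qed.

Section HighestWeight.
Variables (k : int) (l : 'I_m).
Hypothesis k_le0 : k <= 0.
Local Notation b0 := (U_(xT l) *+ `|k|%N)%MM.

Lemma hwvT i : b0 (xT i) = ((l == i) * `|k|)%N.
Proof. by rewrite mulmnE mnm1E ixT_eq. Qed.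

Lemma hwvS i : b0 (xS i) = 0%N.
Proof. by rewrite mulmnE mnm1E ixTS_eq. Qed.

Lemma hwvp : b0 p = 0%N.
Proof. by rewrite mulmnE mnm1E ixTp_eq. Qed.

Lemma hwvq : b0 q = 0%N.
Proof. by rewrite mulmnE mnm1E ixTq_eq. Qed.

Lemma sum_hwvT : (\sum_i b0 (xT i) = `|k|)%N.
Proof.
rewrite (bigD1 l) //= hwvT eqxx mul1n big1 ?addn0 // => i.
by rewrite hwvT eq_sym => /negPf->.
Qed.

Lemma osc_degree_hwv : osc_degree (osc_T n) b0 = k.
Proof.
rewrite (osc_degree_T (hn := hn) hwvS) hwvp hwvq sum_hwvT; lia.
Qed.

Lemma hwv_harmonic : Harm k 'X_[b0].
Proof.
rewrite -(harmonic_family_mpolyX hwvS) -[X in harmonic _ _ X _]osc_degree_hwv.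
by apply: harmonic_family_harmonic; rewrite hwvp.
Qed.

Lemma cartan_weight_sep b : osc_degree (osc_T n) b = k ->
  (forall u, cartan_weight u b = cartan_weight u b0) -> b = b0.
Proof.
move=> db wb.
have bT i : (b (xT i) + b (xS i) = b0 (xT i))%N.
  have := wb (xT i); rewrite !cartan_weightT hwvS addn0 => /oppr_inj/eqP.
  by rewrite eqr_nat => /eqP[].
have bpq : b p = b q.
  have := wb p; rewrite !cartan_weightp hwvp hwvq subrr => /eqP.
  by rewrite subr_eq0 eqr_nat => /eqP.
have sS : (b p + \sum_i b (xS i) = 0)%N.
  have sT : (\sum_i b (xT i) + \sum_i b (xS i) = `|k|)%N.
    by rewrite -big_split -sum_hwvT; apply: eq_bigr => i _; apply: bT.
  move: db; rewrite (osc_degree_ix4 hn) sumrB -bpq.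
  have z (G : 'I_m -> nat) : \sum_i (G i)%:Z = (\sum_i G i)%N%:Z.
    by rewrite -[RHS]natz natr_sum; apply: eq_bigr => i _; rewrite natz.
  rewrite !z; move: sT; move: (\sum_i _)%N (\sum_i _)%N => s1 s2; lia.
have bS i : b (xS i) = 0%N.
  have : (\sum_i b (xS i) == 0)%N by lia.
  by rewrite sum_nat_eq0 => /forallP/(_ i)/eqP.
apply/mnmP => u; case: (ix4P hn u) => [i|i||].
- by rewrite -bT bS addn0.
- by rewrite bS hwvS.
- by rewrite hwvp; lia.
- by rewrite hwvq; lia.
Qed.

Lemma weight_projection (U : A -> Prop) f : is_subspace U ->
  (forall u g, U g -> U (Skew u u g)) -> gr k f -> U f -> f@_b0 != 0 ->
  U 'X_[b0].
Proof.
move=> sU US; move: {2}(size (msupp f)) (leqnn (size (msupp f))) => s.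
elim: s f => [|s ih] f hs hf Uf f0.
  move: hs f0; rewrite leqn0 size_eq0 msupp_eq0 => /eqP->.
  by rewrite mcoeff0 eqxx.
have [hall|] := boolP (all (pred1 b0) (msupp f)).
  apply: (subspace_scaleI sU f0); have -> : f@_b0 *: 'X_[b0] = f; last by [].
  apply/mpolyP => b; rewrite mcoeffZ mcoeffX; case: eqP => [<-|ne].
    exact: mulr1.
  rewrite mulr0; apply/esym/eqP; rewrite mcoeff_eq0; apply/negP => bf.
  by move/allP: hall => /(_ _ bf)/eqP e; case: ne.
case/allPn => b bf /= bb0.
have [u wu] : exists u, cartan_weight u b != cartan_weight u b0.
  apply: NNPP => no; case/eqP: bb0; apply: cartan_weight_sep.
    by move/osc_gradedP: hf; apply; rewrite -mcoeff_msupp.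
  by move=> u; apply/eqP; apply: contraT => hu; case: no; exists u.
pose g := Skew u u f - cartan_weight u b *: f.
have gE a : g@_a = (cartan_weight u a - cartan_weight u b) * f@_a.
  by rewrite mcoeffB mcoeffZ mcoeff_skew_diag [RHS]mulrBl.
have gf a : a \in msupp g -> (a != b) && (a \in msupp f).
  rewrite !mcoeff_msupp gE mulf_eq0 negb_or => /andP[h ->]; rewrite andbT.
  by apply: contraNneq h => ->; rewrite subrr.
apply: (ih g).
- have sz : (size (msupp g) <= size (rem b (msupp f)))%N.
    apply: uniq_leq_size (msupp_uniq _) _ => a /gf ha.
    by rewrite mem_rem_uniq ?msupp_uniq // inE.
  move: sz hs; rewrite size_rem //; case: (size (msupp f)) => [|s'] /= h1 h2.
    exact: leq_trans h1 _.
  exact: leq_trans h1 h2.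
- apply/osc_gradedP => a; rewrite -mcoeff_msupp => /gf/andP[_].
  by rewrite mcoeff_msupp; move/osc_gradedP: hf; apply.
- by apply: subspaceB => //; [apply: US | apply: subspaceZ].
- by rewrite gE mulf_neq0 // subr_eq0 eq_sym.
Qed.

Lemma ann_hwv u : (u \notin osc_T n) -> ann (osc_T n) u ('X_[b0] : A) = 0.
Proof.
move=> uT; rewrite /ann (negPf uT) mderivX mulmnE mnm1E.
by case: eqP uT => [<-|_ _]; rewrite ?ixT_T // mul0n scale0r.
Qed.

Lemma hwv_skew u w : u \in osc_T n ->
  (w \in osc_T n -> (u != xT l) && (u != w)) -> Skew u w 'X_[b0] = 0.
Proof.
move=> uT uw; rewrite /skew [ann _ (star u) _]ann_hwv ?star_disjoint //.
rewrite linear0 subr0.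
have [wT|wT] := boolP (w \in osc_T n); last by rewrite ann_hwv ?linear0.
have /andP[ul /negPf u_w] := uw wT.
have du : ('X_[b0] : A)^`M(u) = 0.
  by rewrite mderivX mulmnE mnm1E eq_sym (negPf ul) mul0n scale0r.
rewrite /cre /ann uT wT linearN /= mderivM mderivXi u_w mul0r add0r du mulr0.
exact: oppr0.
Qed.

Section Module.
Variable g : {vspace 'M[K]_(2 * n)}.
Hypothesis g_skew : forall M, M \in g -> skew_symmetric star M.
Hypothesis skew_mx_g : forall u w, skew_mx (K := K) star u w \in g.

Lemma generated_by_hwv :
  generated_by g (osc_rep (osc_T n)) (Harm k) 'X_[b0].
Proof.
split; [|exact: hwv_harmonic|].
  by apply: harmonic_submodule => //; apply: starK.
move=> U hU Uv w hw; case: (hU) => sU _.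
apply: (span_harmonic (U := U) k_le0 sU _ Uv hw) => u1 u2 f Uf.
exact: (submodule_skew skew_mx_g).
Qed.

Lemma hwv_irreducible : is_irreducible g (osc_rep (osc_T n)) (Harm k).
Proof.
pose sgn (u : 'I_(2 * n)) : K := if (u < n)%N then -1 else 1.
have sgn_sqr u : sgn u * sgn u = 1.
  by rewrite /sgn; case: ifP => _; rewrite ?mulrNN mulr1.
have sgn_star u : sgn (star u) = - sgn u.
  rewrite /sgn; case: (ixP hn u) => i hi.
    have -> : (star (ix hn i) < n)%N = false by rewrite star_low // ixE; lia.
    have -> : (ix hn i < n)%N by rewrite ixE; lia.
    by rewrite opprK.
  have -> : (star (ix hn (n + i)) < n)%N by rewrite star_high // ixE; lia.
  by have -> : (ix hn (n + i) < n)%N = false by rewrite ixE; lia.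
apply: (harmonic_irreducible (@starK _ hn) sgn_sqr sgn_star g_skew skew_mx_g
  (harmonic_direct_sum k_le0) _ generated_by_hwv).
  by rewrite -msupp_eq0 msuppX.
move=> U hU UH [f Uf].
rewrite fischerC fischerX mulf_eq0 negb_or => /andP[_ f0].
apply: (weight_projection (hU.1) _ _ Uf f0).
  by move=> u h; apply: (submodule_skew skew_mx_g).
by case: (UH _ Uf).
Qed.

End Module.

End HighestWeight.
End Irreducibility.

Section HarmonicModule.
Context {R : realType} {n : nat} (hn : (2 <= n)%N).
Local Notation C := R[i].
Local Notation m := n.-1.
Local Notation ix := (ix hn).
Local Notation star := (star hn).
Local Notation A := {mpoly C[2 * n]}.
Local Notation rho := (osc_rep (K := C) (osc_T n)).
Local Notation eps := (fun i => skew_mx (K := C) star (ix i) (ix i)).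
Implicit Types (a : 'X_{1..2 * n}) (i j : nat).

Lemma harmonic_indexE k a : harmonic_index hn k a =
  free_mnm hn a && (osc_degree (osc_T n) a == k).
Proof.
rewrite /harmonic_index /free_mnm (osc_degree_ix4 hn) sumrB /ixp /ixq.
congr (_ && (_ == _)); rewrite big_nat_recr /=; last by lia.
rewrite -ix_last !big_add1 !big_mkord -!addrA; congr (_ + _).
by rewrite addrCA.
Qed.

Lemma harmonic_polyE a : harmonic_poly R hn a = harmonic_family (K := C) hn a.
Proof.
apply: eq_bigr => r _; congr (_ *: _).
rewrite [RHS]mpolyXE_id (big_ix4 hn) /= !harmonic_mnmp !harmonic_mnmq.
congr (_ * _).
by apply: eq_bigr => i _; rewrite harmonic_mnmT harmonic_mnmS.
Qed.

Lemma so_positive_ind (P : 'M[C]_(2 * n) -> Prop) :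
  P 0 -> (forall M1 M2, P M1 -> P M2 -> P (M1 + M2)) ->
  (forall c M, P M -> P (c *: M)) ->
  (forall i j, (1 <= i < j)%N -> (j <= n)%N ->
    P (skew_mx star (ix i) (ix j)) /\ P (skew_mx star (ix i) (ix (n + j)))) ->
  forall M, M \in so_positive R hn -> P M.
Proof.
move=> P0 PD PZ Pg M; rewrite /so_positive big_nat.
apply: memv_big_add_ind => // i hi; rewrite big_nat.
apply: memv_big_add_ind => // j hj ?.
move=> /memv_addP[_ /vlineP[c1 ->] [_ /vlineP[c2 ->] ->]].
have [||P1 P2] := Pg i j; try lia.
have hi' : (1 <= i <= n)%N by lia.
have hj' : (1 <= j <= n)%N by lia.
apply: PD; apply: PZ.
  by move: P1; rewrite /skew_mx !star_low.
by move: P2; rewrite /skew_mx star_high // star_low.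
Qed.

Lemma so_cartan_ind (P : 'M[C]_(2 * n) -> Prop) :
  P 0 -> (forall M1 M2, P M1 -> P M2 -> P (M1 + M2)) ->
  (forall c M, P M -> P (c *: M)) ->
  (forall i, (1 <= i <= n)%N -> P (eps i)) ->
  forall M, M \in so_cartan R hn -> P M.
Proof.
move=> P0 PD PZ Pg M; rewrite /so_cartan big_nat.
apply: memv_big_add_ind => // i hi _ /vlineP[c ->].
by have := Pg i hi; rewrite /skew_mx star_low // => /(PZ c).
Qed.

Lemma so_corootE j : (1 <= j <= n)%N -> so_coroot R hn j =
  if (j < n)%N then eps j - eps j.+1 else eps n.-1 + eps n.
Proof.
move=> hj; rewrite /so_coroot /skew_mx; case: ifP => h.
  rewrite !star_low ?opprB; try lia.
  by rewrite addrA addrAC.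
rewrite !star_low; try lia.
have -> : ix (2 * n).-1 = ix (n + n.-1) by congr (Defs.ix hn); lia.
by rewrite ix_last addrA.
Qed.

Section CorootDecomposition.
Variable P : 'M[C]_(2 * n) -> Prop.
Hypothesis PD : forall M1 M2, P M1 -> P M2 -> P (M1 + M2).
Hypothesis PZ : forall c M, P M -> P (c *: M).
Hypothesis P_coroot : forall j, (1 <= j <= n)%N -> P (so_coroot R hn j).

Lemma coroot_eps i : (1 <= i <= n)%N -> P (eps i).
Proof.
have n0 : (1 <= n <= n)%N by lia.
have n1 : (1 <= n.-1 <= n)%N by lia.
have Pn : P (eps n).
  have := PZ (2^-1) (PD (P_coroot n0) (PZ (-1) (P_coroot n1))).
  rewrite !so_corootE // ltnn ifT; last by lia.
  rewrite (ltn_predK hn) scaleN1r opprB addrC addrA subrK.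
  rewrite -mulr2n -[skew_mx _ _ _ *+ 2]scaler_nat scalerA mulVf ?scale1r //.
  by rewrite pnatr_eq0.
move: {2}(n - i)%N (erefl (n - i)%N) => t; elim: t i => [|t ih] i ht hi.
  by have -> : i = n by lia.
have Pi : P (eps i.+1) by apply: ih; lia.
have := PD (P_coroot hi) Pi; rewrite so_corootE // ifT; last by lia.
by rewrite subrK.
Qed.

End CorootDecomposition.

Section Weights.
Variables (lam : nat -> so_weight R hn) (hlam : is_fundamental_weights lam).
Variable k : int.
Hypothesis k_le0 : k <= 0.
Variable l : 'I_m.
Hypothesis l_last : l = n.-2 :> nat.
Local Notation mu := ((- k)%:~R *: lam (n - 2)%N + (k - 1)%:~R *: lam (n - 1)%N
           + (k - 1)%:~R *: lam n).
Local Notation b0 := (U_(ixT hn l) *+ `|k|%N)%MM.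
Local Notation v := ('X_[b0] : A).

Lemma eps_hwv i : (1 <= i <= n)%N -> rho (eps i) v =
  (if (i < n)%N then - ((i == n.-1) * `|k|).+1%:R else 0) *: v.
Proof.
move=> hi; rewrite osc_rep_skew_mx skew_diag_mpolyX; congr (_ *: _).
case: ifP => h; last first.
  have -> : ix i = ixp hn by congr (Defs.ix hn); lia.
  by rewrite cartan_weightp hwvp hwvq subrr.
have im : (i.-1 < m)%N by lia.
have -> : ix i = ixT hn (Ordinal im) by congr (Defs.ix hn); rewrite /=; lia.
rewrite cartan_weightT hwvT hwvS addn0; congr (- (_ * _).+1%:R).
by rewrite -val_eqE /= l_last; congr nat_of_bool; lia.
Qed.

Lemma mu_coroot j : (1 <= j <= n)%N ->
  mu (vsproj (so_cartan R hn) (so_coroot R hn j)) =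
  (if (j < n)%N then (if j == n.-1 then k - 1 else if j == n.-2 then - k else 0)
   else k - 1)%:~R :> C.
Proof.
case: hlam => lam0 hl hj.
have hl0 i : (i <= n)%N -> lam i (vsproj (so_cartan R hn) (so_coroot R hn j)) =
    (i == j)%:R :> C.
  case: i => [_|i hi]; last by apply: hl => //; lia.
  by rewrite lam0 zero_lfunE; case: j hj {hl}.
rewrite !add_lfunE !scale_lfunE !hl0; try lia.
rewrite /GRing.scale /=.
have [-> | jn] := eqVneq j n.
  have [-> ->] : (n - 2 == n)%N = false /\ (n - 1 == n)%N = false by lia.
  by rewrite ltnn !mulr0 !add0r mulr1.
have -> : (j < n)%N by lia.
have -> : (n - 1 == j)%N = (j == n.-1) by lia.
have -> : (n - 2 == j)%N = (j == n.-2) by lia.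
have [-> | jn1] := eqVneq j n.-1.
  have -> : (n.-1 == n.-2) = false by lia.
  by rewrite !mulr0 mulr1 add0r addr0.
by case: eqP => _; rewrite !mulr0 ?mulr1 !addr0.
Qed.

Lemma coroot_hwv j : (1 <= j <= n)%N -> rho (so_coroot R hn j) v =
  (mu (vsproj (so_cartan R hn) (so_coroot R hn j)) : C) *: v.
Proof.
move=> hj; rewrite mu_coroot // so_corootE //.
have kE : `|k|%N%:R = (- k)%:~R :> C by rewrite natr_absz ler0_norm.
have n1 : (1 <= n.-1 <= n)%N by lia.
have n0 : (1 <= n <= n)%N by lia.
have lt1 : (n.-1 < n)%N by lia.
case: ifP => h.
  have hj1 : (1 <= j.+1 <= n)%N by lia.
  rewrite osc_repB !eps_hwv // h -scalerBl; congr (_ *: _).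
  have [-> | jn1] := eqVneq j n.-1.
    rewrite (ltn_predK hn) ltnn mul1n subr0 -natr1 kE !rmorphB rmorphN /=.
    by rewrite opprD opprK.
  have -> : (j.+1 < n)%N by lia.
  rewrite opprK addrC -natr1 -[in X in _ + X]natr1 !mul0n add0r addrK.
  have -> : (j.+1 == n.-1) = (j == n.-2) by lia.
  by case: eqP => _; rewrite ?mul1n ?kE.
rewrite osc_repD !eps_hwv // lt1 ltnn eqxx mul1n scale0r addr0 -natr1 kE.
by rewrite rmorphB rmorphN /= opprD opprK.
Qed.

Lemma hwv_highest_weight :
  is_highest_weight_vector (h := so_cartan R hn) (so_rep R n)
    (so_positive R hn) mu v.
Proof.
split; first by rewrite -msupp_eq0 msuppX.
  move=> x; pose mu' := mu; rewrite -/mu'.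
  pose P (M : 'M[C]_(2 * n)) :=
    rho M v = (mu' (vsproj (so_cartan R hn) M) : C) *: v.
  suff : P (vsval x) by rewrite /P vsvalK.
  have PD M1 M2 : P M1 -> P M2 -> P (M1 + M2).
    rewrite /P => h1 h2; rewrite osc_repD h1 h2 (linearD (vsproj _)).
    by rewrite (linearD mu') scalerDl.
  have PZ c M : P M -> P (c *: M).
    rewrite /P => h1; rewrite osc_repZ h1 scalerA; congr (_ *: _).
    by rewrite [vsproj _ (c *: M)]linearZ [RHS]linearZ.
  apply: so_cartan_ind (subvsP x) => //.
    by rewrite /P osc_rep0 !linear0 scale0r.
  by apply: coroot_eps => // j; apply: coroot_hwv.
apply: so_positive_ind => [|M1 M2 h1 h2|c M h1|i j hi hj].
- exact: osc_rep0.
- by move: h1 h2; rewrite /so_rep => h1 h2; rewrite osc_repD h1 h2 addr0.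
- by move: h1; rewrite /so_rep => h1; rewrite osc_repZ h1 scaler0.
rewrite /so_rep !osc_rep_skew_mx.
have hin : (1 <= i <= n)%N by lia.
have hjn : (1 <= j <= n)%N by lia.
have iT : ix i \in osc_T n by rewrite ix_low_T //; lia.
split; apply: hwv_skew => //; last by rewrite ix_high_T.
rewrite ix_low_T // => jn; rewrite -!val_eqE /= ixT_val l_last !ixE; lia.
Qed.

End Weights.
End HarmonicModule.
Theorem theorem3p4 (R : realType) (n : nat) (hn : (2 <= n)%N)
    (lam : nat -> so_weight R hn) (hlam : is_fundamental_weights lam)
    (k : int) (hk : k <= 0) :
  [/\ is_direct_sum (so_graded R n k) (so_harmonic R hn k)
        (image_of (so_eta hn) (so_graded R n (k - 2))),
      is_irreducible (so_even R hn) (so_rep R n) (so_harmonic R hn k),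
      is_highest_weight_module (so_even R hn) (so_rep R n) (so_positive R hn)
        (so_harmonic R hn k)
        ((- k)%:~R *: lam (n - 2)%N + (k - 1)%:~R *: lam (n - 1)%N
           + (k - 1)%:~R *: lam n)
        ('X_(ix hn (n - 1)) ^+ `|- k|%N) &
      is_basis (harmonic_index hn k) (harmonic_poly R hn)
        (so_harmonic R hn k)].
Proof.
have l_lt : (n.-2 < n.-1)%N by lia.
pose l : 'I_n.-1 := Ordinal l_lt.
have eH : so_harmonic R hn k = harmonic (K := R[i]) (osc_T n) (star hn) k.
  by apply: functional_extensionality => f; apply: so_harmonicE.
have eE : so_eta hn = raise (K := R[i]) (osc_T n) (star hn).
  by apply: functional_extensionality => f; apply: so_etaE.
have eP : harmonic_poly R hn = harmonic_family (K := R[i]) hn.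
  by apply: functional_extensionality => a; apply: harmonic_polyE.
have eI : harmonic_index hn k =
    (fun a => free_mnm hn a && (osc_degree (osc_T n) a == k)).
  by apply: functional_extensionality => a; apply: harmonic_indexE.
have ev : 'X_(ix hn (n - 1)) ^+ `|- k|%N =
    'X_[U_(ixT hn l) *+ `|k|%N] :> {mpoly R[i][2 * n]}.
  rewrite mpolyXn abszN; congr 'X_[U_(_) *+ _].
  by congr (ix hn); rewrite /l /=; lia.
rewrite eH eE eP eI ev; split.
- exact: harmonic_direct_sum.
- apply: (hwv_irreducible l hk); first exact: so_even_skew.
  exact: skew_mx_so_even.
- split; first exact: hwv_highest_weight.
  apply: (generated_by_hwv l hk); first exact: so_even_skew.
  exact: skew_mx_so_even.
- exact: harmonic_family_basis.
Qed.
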